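(* Let $Q$ be the unique positive, decaying solution, smooth on $[0,\infty)$, of $-y''(r)-\frac{2}{r}y'(r)+y(r)-y^3(r)=0$, and let $$L_+=-\frac{d^2}{dr^2}-\frac{2}{r}\frac{d}{dr}+1-3Q^2(r)$$ on $(0,\infty)$. Then $L_+$ has no ($L^2(\mathbb{R}^+)$) eigenvalue or resonance in $[0,1]$.
   Context: $Q$ is the ground state of the cubic radial equation $-y''-\frac2r y'+y-y^3=0$ in three dimensions; by a theorem of Coffman there is a unique positive decaying solution that is smooth on $[0,\infty)$. Meaning of ''eigenvalue or resonance'': $\lambda\in[0,1]$ is an eigenvalue or resonance of $L_+$ if there is a not identically zero solution $u$ of $L_+u=\lambda u$ on $(0,\infty)$ which is bounded near $r=0$ and satisfies $u(r)=O\big(r^{-1}e^{-r\sqrt{1-\lambda}}\big)$ as $r\to\infty$ (for $\lambda<1$ this is the same as $u$ being bounded near $0$ and square integrable at infinity; for $\lambda=1$ it says that $u$ decays like $1/r$). Equivalently, with $u_1$ the solution of $L_+u=\lambda u$ with $u_1(0;\lambda)=1$ and $u_2$ the solution with $u_2(r;\lambda)=r^{-1}e^{-r\sqrt{1-\lambda}}(1+o(1))$ as $r\to\infty$, the Wronskian $u_1u_2'-u_2u_1'$ vanishes. *)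

(* Defs.v *)
From Stdlib Require Import Reals.
From Coquelicot Require Import Coquelicot.
Open Scope R_scope.

(** Radial functions are represented by total functions [R -> R]; every
    condition below concerns only their values on [0, +oo) (or (0, +oo)). *)

(** Smoothness on the closed half-line [0, +oo): derivatives of every order,
    one-sided at 0.  [D n] is the n-th derivative, and [D_in] is
    differentiation relative to the given domain. *)
Definition smooth_on_halfline (f : R -> R) : Prop :=
  exists D : nat -> R -> R,
    (forall r, 0 <= r -> D 0%nat r = f r) /\
    (forall n r, 0 <= r -> D_in (D n) (D (S n)) (fun x => 0 <= x) r).

(** [Derive] and [Derive_n] are total; here they are genuine derivatives at
    every r > 0 because of the smoothness clause. *)
Definition ground_state (y : R -> R) : Prop :=
  smooth_on_halfline y /\
  (forall r, 0 <= r -> 0 < y r) /\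
  is_lim y p_infty 0 /\
  (forall r, 0 < r ->
     - Derive_n y 2 r - 2 / r * Derive y r + y r - y r ^ 3 = 0).

(** Uniqueness is agreement on [0, +oo): Leibniz equality in [R -> R] would
    be unsatisfiable, the values at r < 0 being arbitrary. *)
Definition unique_ground_state (Q : R -> R) : Prop :=
  ground_state Q /\
  forall y, ground_state y -> forall r, 0 <= r -> y r = Q r.

Definition Lplus (Q u : R -> R) (r : R) : R :=
  - Derive_n u 2 r - 2 / r * Derive u r + (1 - 3 * Q r ^ 2) * u r.

(** Existence of both derivatives is required explicitly: [ex_derive_n u 2 r]
    alone only says that the total function [Derive u] is differentiable. *)
Definition solves_Lplus (Q : R -> R) (lam : R) (u : R -> R) : Prop :=
  forall r, 0 < r ->
    ex_derive u r /\ ex_derive_n u 2 r /\ Lplus Q u r = lam * u r.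

Definition eigenvalue_or_resonance (Q : R -> R) (lam : R) : Prop :=
  exists u : R -> R,
    solves_Lplus Q lam u /\
    (exists r, 0 < r /\ u r <> 0) /\
    (exists M, at_right 0 (fun r => Rabs (u r) <= M)) /\
    (exists C, Rbar_locally p_infty
       (fun r => Rabs (u r) <= C * (/ r * exp (- r * sqrt (1 - lam))))).

(* Main.v *)
Require Import Defs.
From Stdlib Require Import Reals Lra Lia ZArith List.
From Coquelicot Require Import Coquelicot.
Open Scope R_scope.

(** Every solution in question, multiplied by [r], satisfies [v'' = (1 - lam - 3 Q^2) v] with
    [v = O(r)] at the origin and [v] bounded at infinity.  The proof shows that such a [v]
    vanishes, for all [lam] at once, by three observations.

    1. A nontrivial [v] has a zero [z > 0].  Indeed [q = r Q] is positive and satisfies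
    [q'' = (1 - Q^2) q], where [1 - Q^2 > 1 - lam - 3 Q^2]; if [v] were positive, the Wronskian
    would push [v / q] to [-oo] ([solution_has_zero]).

    2. It suffices to cut the half-line at one point [a] and to find positive strict
    supersolutions of [- w'' - 3 Q^2 w = 0] on each side, regular at [0] on the left and
    with [w' >= 0] at infinity on the right.  By Picone's identity the supersolution to the
    left of [a] forces [v = 0] on [(0, z)] if [z <= a], and the one to the right forces [v = 0]
    beyond [z] if [z >= a] ([bounded_regular_solution_zero]).  Since [1 - lam >= 0] only helps,
    all of [0, 1] reduces to the threshold potential [- 3 Q^2].

    3. Larger potentials are harder, so only upper bounds for [Q] matter.  The potential
    tolerates an increase of about 3 percent, hence [Q] must be known to about one percent.

    To bound [Q], rescale it as [Y s = c Q (c s)] with [c = 6 / Q 0].  Then [Y 0 = 6] and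
    [Y'' + 2 Y'/s = eps Y - Y^3] with the unknown mass [eps = c^2], whose true value is about
    1.914, and everything of interest happens on [(0, 1]].  The key fact is a Sturm
    comparison in the mass ([sturm_comparison]): two profiles with masses [e1 < e2] keep the
    same order of values and of logarithmic derivatives while the difference of their
    squares is below [e2 - e1], and this difference is estimated a priori by a fixed multiple
    of [e2 - e1] ([square_gap_below], [square_gap_above]).  So explicit approximate
    solutions can replace the exact ones, and no existence theory for the equation is needed.

    - Comparison with an explicit profile of mass about 1.93 shows that a mass of at least 1.97
      would give [(q')^2 - eps q^2 + q^4 / (2 s^2) <= 0] somewhere, while this quantity decreases
      to [0] along the ground state and is therefore positive ([mass_lt]).
    - Comparison with an explicit profile of mass about 2.01 then bounds [Y] from above on
      [(0, 1]], and bounds its logarithmic derivative at [1]; the latter decreases further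
      on, which yields an exponential bound for the tail ([potential_le], [potential_tail]).

    The supersolutions for the resulting potential are explicit as well: polynomials on both sides of
    [a = 6/17] up to [1], an exponential expression beyond.  All numerical claims are
    positivity statements for integer polynomials on an interval ([positive_on_spec]). *)

(** * Differentiation rules for real functions *)

Lemma is_derive_to (f : R -> R) (x l l' : R) :
  is_derive f x l -> l = l' :> R -> is_derive f x l'.
Proof. now intros H <-. Qed.

Lemma derive_const (c : R) x : is_derive (fun _ => c) x 0.
Proof. apply (is_derive_const (V := R_NormedModule)). Qed.

Lemma derive_id x : is_derive (fun t => t) x 1.
Proof. apply (is_derive_id (K := R_AbsRing)). Qed.

Lemma derive_plus (f g : R -> R) x a b :
  is_derive f x a -> is_derive g x b -> is_derive (fun t => f t + g t) x (a + b).
Proof. apply (is_derive_plus (V := R_NormedModule)). Qed.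

Lemma derive_minus (f g : R -> R) x a b :
  is_derive f x a -> is_derive g x b -> is_derive (fun t => f t - g t) x (a - b).
Proof. apply (is_derive_minus (V := R_NormedModule)). Qed.

Lemma derive_opp (f : R -> R) x a :
  is_derive f x a -> is_derive (fun t => - f t) x (- a).
Proof. apply (is_derive_opp (V := R_NormedModule)). Qed.

Lemma derive_mult (f g : R -> R) x a b :
  is_derive f x a -> is_derive g x b ->
  is_derive (fun t => f t * g t) x (a * g x + f x * b).
Proof.
  intros Hf Hg. apply (is_derive_mult f g x a b Hf Hg). intros u v. apply Rmult_comm.
Qed.

Lemma derive_comp (f g : R -> R) x a b :
  is_derive f (g x) a -> is_derive g x b -> is_derive (fun t => f (g t)) x (b * a).
Proof. apply (is_derive_comp (V := R_NormedModule)). Qed.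

Lemma derive_pow n (f : R -> R) x a :
  is_derive f x a -> is_derive (fun t => f t ^ n) x (INR n * a * f x ^ pred n).
Proof. apply is_derive_pow. Qed.

Lemma derive_div (f g : R -> R) x a b :
  is_derive f x a -> is_derive g x b -> g x <> 0 ->
  is_derive (fun t => f t / g t) x ((a * g x - f x * b) / g x ^ 2).
Proof. apply is_derive_div. Qed.

Lemma derive_exp (f : R -> R) x a :
  is_derive f x a -> is_derive (fun t => exp (f t)) x (a * exp (f x)).
Proof. intros H. apply (derive_comp exp f); [apply is_derive_exp | exact H]. Qed.

(** Differentiates an arithmetic expression whose atoms have their derivatives
    in the context; the computed derivative remains to be matched. *)
Ltac derive_step :=
  lazymatch goal with
  | |- is_derive (fun _ => ?c) _ _ => apply derive_const
  | |- is_derive (fun t => t) _ _ => apply derive_id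
  | |- is_derive (fun t => @?f t + @?g t) _ _ => eapply (derive_plus f g)
  | |- is_derive (fun t => @?f t - @?g t) _ _ => eapply (derive_minus f g)
  | |- is_derive (fun t => - @?f t) _ _ => eapply (derive_opp f)
  | |- is_derive (fun t => @?f t * @?g t) _ _ => eapply (derive_mult f g)
  | |- is_derive (fun t => @?f t / @?g t) _ _ => eapply (derive_div f g)
  | |- is_derive (fun t => @?f t ^ ?n) _ _ => eapply (derive_pow n f)
  | |- is_derive (fun t => exp (@?f t)) _ _ => eapply (derive_exp f)
  | |- is_derive _ _ _ => eassumption
  end.

Ltac derive := eapply is_derive_to; [repeat derive_step | cbn [pred INR]].

(** * Calculus on an interval *)

Lemma is_derive_continuity (f : R -> R) x l : is_derive f x l -> continuity_pt f x.
Proof.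
  intros H. apply continuity_pt_filterlim, (ex_derive_continuous f). now exists l.
Qed.

Lemma nondecreasing_of_derive (f f' : R -> R) a b :
  a <= b ->
  (forall x, a <= x <= b -> is_derive f x (f' x)) ->
  (forall x, a <= x <= b -> 0 <= f' x) ->
  f a <= f b.
Proof.
  intros Hab Hd Hp.
  destruct (MVT_gen f a b f') as [c [Hc He]].
  - rewrite Rmin_left, Rmax_right by lra. intros x Hx. apply Hd; lra.
  - rewrite Rmin_left, Rmax_right by lra. intros x Hx.
    apply is_derive_continuity with (f' x), Hd, Hx.
  - rewrite Rmin_left, Rmax_right in Hc by lra.
    assert (0 <= f' c * (b - a)) by (apply Rmult_le_pos; [now apply Hp | lra]). lra.
Qed.

Lemma increasing_of_derive (f f' : R -> R) a b :
  a < b ->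
  (forall x, a <= x <= b -> is_derive f x (f' x)) ->
  (forall x, a <= x <= b -> 0 < f' x) ->
  f a < f b.
Proof.
  intros Hab Hd Hp.
  destruct (MVT_gen f a b f') as [c [Hc He]].
  - rewrite Rmin_left, Rmax_right by lra. intros x Hx. apply Hd; lra.
  - rewrite Rmin_left, Rmax_right by lra. intros x Hx.
    apply is_derive_continuity with (f' x), Hd, Hx.
  - rewrite Rmin_left, Rmax_right in Hc by lra.
    assert (0 < f' c * (b - a)) by (apply Rmult_lt_0_compat; [now apply Hp | lra]). lra.
Qed.

Lemma first_crossing (f : R -> R) a b :
  a < b ->
  (forall x, a <= x <= b -> continuity_pt f x) ->
  f a < 0 -> 0 <= f b ->
  exists m, a < m <= b /\ f m = 0 /\ forall t, a <= t < m -> f t < 0.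
Proof.
  intros Hab Hc Ha Hb.
  set (E := fun t => a <= t <= b /\ forall u, a <= u <= t -> f u < 0).
  destruct (completeness E) as [m [Hub Hlub]].
  - exists b. intros t [Ht _]. lra.
  - exists a. split; [lra |]. intros u Hu. now replace u with a by lra.
  - assert (Ham : a <= m).
    { apply Hub. split; [lra |]. intros u Hu. now replace u with a by lra. }
    assert (Hmb : m <= b) by (apply Hlub; intros t [Ht _]; lra).
    assert (Hbelow : forall t, a <= t < m -> f t < 0).
    { intros t Ht. destruct (Rlt_dec (f t) 0) as [|Hn]; [assumption | exfalso].
      assert (m <= t); [| lra]. apply Hlub. intros u [Hu Hf].
      destruct (Rle_dec u t) as [|Hut]; [assumption | exfalso].
      apply Hn, Hf. lra. }
    assert (Hm0 : ~ f m < 0).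
    { intros Hneg.
      destruct (Rle_lt_or_eq_dec m b Hmb) as [Hlt | ->]; [| lra].
      destruct (Hc m (conj Ham Hmb) (- f m) ltac:(lra)) as [d [Hd Hdc]].
      set (t := Rmin (m + d / 2) b).
      assert (Ht : m < t <= m + d / 2 /\ t <= b).
      { unfold t. split; [split |]; [apply Rmin_glb_lt; lra | apply Rmin_l | apply Rmin_r]. }
      assert (t <= m); [| lra]. apply Hub. split; [lra |]. intros u Hu.
      destruct (Rlt_dec u m) as [Hum | Hum]; [apply Hbelow; lra |].
      destruct (Req_dec u m) as [-> | Hne]; [assumption |].
      specialize (Hdc u). unfold dist in Hdc; simpl in Hdc; unfold Rdist, D_x, no_cond in Hdc.
      assert (Rabs (f u - f m) < - f m).
      { apply Hdc. split; [split; [trivial | lra] |]. rewrite Rabs_right; lra. }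
      apply Rabs_def2 in H. lra. }
    assert (Hm1 : ~ 0 < f m).
    { intros Hpos. assert (a < m) by (destruct (Req_dec a m) as [<- | ]; lra).
      destruct (Hc m (conj Ham Hmb) (f m) Hpos) as [d [Hd Hdc]].
      set (t := Rmax (m - d / 2) a).
      assert (Ht : m - d / 2 <= t < m /\ a <= t).
      { unfold t. split; [split |]; [apply Rmax_l | apply Rmax_lub_lt; lra | apply Rmax_r]. }
      specialize (Hdc t). unfold dist in Hdc; simpl in Hdc; unfold Rdist, D_x, no_cond in Hdc.
      assert (Rabs (f t - f m) < f m).
      { apply Hdc. split; [split; [trivial | lra] |]. rewrite Rabs_left; lra. }
      apply Rabs_def2 in H0. specialize (Hbelow t ltac:(lra)). lra. }
    exists m. repeat split; try lra.
    + destruct (Req_dec a m) as [<- | ]; lra.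
    + exact Hbelow.
Qed.

(** Orders of vanishing at [0] are all that the singular end of a radial
    equation requires: an explicit [O(s^n)] replaces limits at [0]. *)
Definition near0 (n : nat) (f : R -> R) : Prop :=
  exists C d, 0 < d /\ forall s, 0 < s < d -> Rabs (f s) <= C * s ^ n.

Lemma near0_ext n f g : (forall s, 0 < s -> f s = g s) -> near0 n f -> near0 n g.
Proof.
  intros He (C & d & Hd & H). exists C, d. split; [assumption |].
  intros s Hs. rewrite <- He by lra. now apply H.
Qed.

Lemma near0_plus n f g : near0 n f -> near0 n g -> near0 n (fun s => f s + g s).
Proof.
  intros (C & d & Hd & H) (C' & d' & Hd' & H'). exists (C + C'), (Rmin d d').
  split; [now apply Rmin_pos |]. intros s Hs.
  pose proof (Rmin_l d d'). pose proof (Rmin_r d d').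
  eapply Rle_trans; [apply Rabs_triang |].
  specialize (H s ltac:(lra)). specialize (H' s ltac:(lra)). lra.
Qed.

Lemma near0_mult n m f g :
  near0 n f -> near0 m g -> near0 (n + m) (fun s => f s * g s).
Proof.
  intros (C & d & Hd & H) (C' & d' & Hd' & H'). exists (C * C'), (Rmin d d').
  split; [now apply Rmin_pos |]. intros s Hs.
  pose proof (Rmin_l d d'). pose proof (Rmin_r d d').
  rewrite Rabs_mult, pow_add.
  replace (C * C' * (s ^ n * s ^ m)) with ((C * s ^ n) * (C' * s ^ m)) by ring.
  apply Rmult_le_compat; try apply Rabs_pos; [apply H | apply H']; lra.
Qed.

Lemma near0_const c : near0 0 (fun _ => c).
Proof. exists (Rabs c), 1. split; [lra |]. intros. simpl. lra. Qed.

Lemma near0_pow n : near0 n (fun s => s ^ n).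
Proof.
  exists 1, 1. split; [lra |]. intros s Hs.
  rewrite Rabs_right; [lra |]. apply Rle_ge, pow_le. lra.
Qed.

Lemma near0_weaken n m f : (m <= n)%nat -> near0 n f -> near0 m f.
Proof.
  intros Hnm (C & d & Hd & H). exists (Rabs C), (Rmin d 1).
  split; [apply Rmin_pos; lra |]. intros s Hs.
  pose proof (Rmin_l d 1). pose proof (Rmin_r d 1).
  eapply Rle_trans; [apply H; lra |].
  assert (0 <= s ^ n <= s ^ m).
  { split; [apply pow_le; lra |].
    replace n with (m + (n - m))%nat by lia. rewrite pow_add.
    rewrite <- (Rmult_1_r (s ^ m)) at 2.
    apply Rmult_le_compat_l; [apply pow_le; lra |].
    rewrite <- (pow1 (n - m)). apply pow_incr; lra. }
  apply Rle_trans with (Rabs C * s ^ n).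
  - apply Rmult_le_compat_r; [lra | apply Rle_abs].
  - apply Rmult_le_compat_l; [apply Rabs_pos | lra].
Qed.

Lemma near0_scal n c f : near0 n f -> near0 n (fun s => c * f s).
Proof. exact (near0_mult 0 n _ _ (near0_const c)). Qed.

Lemma near0_bound n f : near0 (S n) f -> forall eta, 0 < eta ->
  exists d, 0 < d /\ forall s, 0 < s < d -> Rabs (f s) < eta.
Proof.
  intros Hf eta He. apply (near0_weaken (S n) 1) in Hf; [| lia].
  destruct Hf as (C & d & Hd & H).
  assert (HC : 0 < Rabs C + 1) by (pose proof (Rabs_pos C); lra).
  exists (Rmin d (eta / (Rabs C + 1))). split.
  { apply Rmin_pos; [assumption | now apply Rdiv_lt_0_compat]. }
  intros s [Hs0 Hs].
  pose proof (Rmin_l d (eta / (Rabs C + 1))). pose proof (Rmin_r d (eta / (Rabs C + 1))).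
  eapply Rle_lt_trans; [apply H; lra |]. simpl. rewrite Rmult_1_r.
  apply Rle_lt_trans with ((Rabs C + 1) * s).
  - apply Rmult_le_compat_r; [lra |]. pose proof (Rle_abs C). lra.
  - assert (s < eta / (Rabs C + 1)) by lra.
    apply Rmult_lt_compat_l with (r := Rabs C + 1) in H2; [| assumption].
    replace ((Rabs C + 1) * (eta / (Rabs C + 1))) with eta in H2 by (field; lra). lra.
Qed.

Lemma near0_inv f l : l <> 0 -> near0 1 (fun s => f s - l) -> near0 0 (fun s => / f s).
Proof.
  intros Hl Hf. assert (Hp : 0 < Rabs l) by now apply Rabs_pos_lt.
  destruct (near0_bound 0 _ Hf (Rabs l / 2) ltac:(lra)) as (d & Hd & H).
  exists (2 / Rabs l), d. split; [assumption |]. intros s Hs. specialize (H s Hs).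
  assert (Hfs : Rabs l / 2 <= Rabs (f s)).
  { pose proof (Rabs_triang (f s) (l - f s)).
    replace (f s + (l - f s)) with l in H0 by ring.
    rewrite <- (Rabs_Ropp (l - f s)) in H0.
    replace (- (l - f s)) with (f s - l) in H0 by ring. lra. }
  rewrite Rabs_inv. simpl. rewrite Rmult_1_r.
  replace (2 / Rabs l) with (/ (Rabs l / 2)) by (field; lra).
  apply Rinv_le_contravar; lra.
Qed.

Lemma nonneg_from_zero (f f' : R -> R) b :
  (forall s, 0 < s <= b -> is_derive f s (f' s)) ->
  (forall s, 0 < s <= b -> 0 <= f' s) ->
  near0 1 f ->
  forall s, 0 < s <= b -> 0 <= f s.
Proof.
  intros Hd Hp H0 s Hs. destruct (Rle_dec 0 (f s)) as [|Hn]; [assumption | exfalso].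
  destruct (near0_bound 0 _ H0 (- f s) ltac:(lra)) as (d & Hd0 & H).
  set (t := Rmin (d / 2) s).
  assert (0 < t) by (apply Rmin_pos; lra).
  assert (t <= d / 2) by apply Rmin_l. assert (t <= s) by apply Rmin_r.
  specialize (H t ltac:(lra)). apply Rabs_def2 in H.
  assert (f t <= f s).
  { apply nondecreasing_of_derive with f'; [lra | |]; intros; [apply Hd | apply Hp]; lra. }
  lra.
Qed.

(** Continuous induction: a bound that improves to a strict one as soon as it
    holds weakly up to [t] can never be reached. *)
Lemma bootstrap (f : R -> R) b c :
  (forall s, 0 < s <= b -> continuity_pt f s) ->
  near0 1 f -> 0 < c ->
  (forall t, 0 < t <= b -> (forall s, 0 < s <= t -> f s <= c) -> f t < c) ->
  forall t, 0 < t <= b -> f t < c.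
Proof.
  intros Hc H0 Hpos Hstep t Ht.
  destruct (Rlt_dec (f t) c) as [|Hn]; [assumption | exfalso].
  destruct (near0_bound 0 _ H0 c Hpos) as (d & Hd & H).
  set (a := Rmin (d / 2) t).
  assert (0 < a) by (apply Rmin_pos; lra).
  assert (a <= d / 2) by apply Rmin_l. assert (a <= t) by apply Rmin_r.
  assert (Hsmall : forall s, 0 < s <= a -> f s < c).
  { intros s Hs. specialize (H s ltac:(lra)). apply Rabs_def2 in H. lra. }
  assert (a < t).
  { destruct (Req_dec a t) as [E |]; [| lra]. specialize (Hsmall t ltac:(lra)). lra. }
  destruct (first_crossing (fun s => f s - c) a t) as (m & Hm & Hm0 & Hbelow).
  - assumption.
  - intros x Hx. apply continuity_pt_minus; [apply Hc; lra |].
    apply continuity_pt_const. now intros ? ?.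
  - specialize (Hsmall a ltac:(lra)). lra.
  - lra.
  - assert (f m < c); [| lra]. apply Hstep; [lra |]. intros s Hs.
    destruct (Rle_dec s a); [specialize (Hsmall s ltac:(lra)); lra |].
    destruct (Req_dec s m) as [-> |]; [lra |].
    specialize (Hbelow s ltac:(lra)). lra.
Qed.

(** * Positivity of integer polynomials on an interval *)

(** Polynomials are lists of integer coefficients, constant term first. *)
Fixpoint peval (p : list Z) (x : R) : R :=
  match p with nil => 0 | c :: q => IZR c + x * peval q x end.

Fixpoint padd (p q : list Z) : list Z :=
  match p, q with
  | nil, _ => q
  | _, nil => p
  | a :: p', b :: q' => (a + b)%Z :: padd p' q'
  end.

Definition pscale (c : Z) (p : list Z) : list Z := map (Z.mul c) p.

Fixpoint pmul (p q : list Z) : list Z :=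
  match p with nil => nil | a :: p' => padd (pscale a q) (0%Z :: pmul p' q) end.

Fixpoint pderiv (p : list Z) : list Z :=
  match p with nil => nil | _ :: q => padd q (0%Z :: pderiv q) end.

Fixpoint compose_square (p : list Z) : list Z :=
  match p with nil => nil | a :: q => a :: 0%Z :: compose_square q end.

Lemma peval_add p q x : peval (padd p q) x = peval p x + peval q x.
Proof.
  revert q. induction p as [|a p IH]; intros [|b q]; simpl; try ring.
  rewrite IH, plus_IZR. ring.
Qed.

Lemma peval_scale c p x : peval (pscale c p) x = IZR c * peval p x.
Proof. induction p as [|a p IH]; simpl; [ring | rewrite IH, mult_IZR; ring]. Qed.

Lemma peval_mul p q x : peval (pmul p q) x = peval p x * peval q x.
Proof.
  induction p as [|a p IH]; simpl; [ring |].
  rewrite peval_add, peval_scale. simpl. rewrite IH. ring.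
Qed.

Lemma peval_compose_square p x : peval (compose_square p) x = peval p (x ^ 2).
Proof. induction p as [|a p IH]; simpl; [ring |]. rewrite IH. simpl. ring. Qed.

Lemma is_derive_peval p x : is_derive (peval p) x (peval (pderiv p) x).
Proof.
  induction p as [|a p IH]; simpl.
  - apply (is_derive_const (V := R_NormedModule)).
  - rewrite peval_add. simpl.
    derive. simpl. ring.
Qed.

(** [p (y / k)] multiplied by [k^deg p], which keeps the coefficients integral. *)
Fixpoint dilate (k : Z) (p : list Z) : list Z :=
  match p with
  | nil => nil
  | c :: q => (c * k ^ Z.of_nat (length q))%Z :: dilate k q
  end.

(** The local binding matters: without it the cost would be exponential in the degree. *)
Fixpoint taylor_shift (p : list Z) : list Z :=
  match p with nil => nil | c :: q => let r := taylor_shift q in padd (c :: r) r end.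

Definition unit_lower_bound (p : list Z) : Z :=
  match p with nil => 0 | c :: q => c + fold_right (fun a m => Z.min 0 a + m) 0 q end%Z.

Fixpoint positive_steps (n : nat) (p : list Z) : bool :=
  match n with
  | O => true
  | S n' => andb (0 <? unit_lower_bound p)%Z (positive_steps n' (taylor_shift p))
  end.

(** Covers [a/k, (a+n)/k] by [n] intervals of length [1/k]; on each of them the
    Taylor polynomial at the left end is bounded below by its constant
    coefficient plus its negative coefficients. *)
Definition positive_on (k : Z) (a n : nat) (p : list Z) : bool :=
  positive_steps n (Nat.iter a taylor_shift (dilate k p)).

Lemma peval_dilate k p x :
  peval (dilate k p) (IZR k * x) * IZR k = IZR k ^ length p * peval p x.
Proof.
  induction p as [|c p IH]; simpl; [ring |].
  rewrite mult_IZR, <- pow_IZR.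
  replace ((IZR c * IZR k ^ length p + IZR k * x * peval (dilate k p) (IZR k * x)) * IZR k)
    with (IZR c * IZR k ^ length p * IZR k
          + IZR k * x * (peval (dilate k p) (IZR k * x) * IZR k)) by ring.
  rewrite IH. ring.
Qed.

Lemma peval_taylor_shift p y : peval (taylor_shift p) y = peval p (y + 1).
Proof.
  induction p as [|c p IH]; [reflexivity |].
  change (peval (padd (c :: taylor_shift p) (taylor_shift p)) y = IZR c + (y + 1) * peval p (y + 1)).
  rewrite peval_add. simpl. rewrite IH. ring.
Qed.

Lemma peval_taylor_shift_iter p a y : peval (Nat.iter a taylor_shift p) y = peval p (y + INR a).
Proof.
  revert y. induction a as [|a IH]; intros y.
  - simpl. now rewrite Rplus_0_r.
  - change (peval (taylor_shift (Nat.iter a taylor_shift p)) y = peval p (y + INR (S a))).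
    rewrite peval_taylor_shift, IH, S_INR. f_equal. ring.
Qed.

Lemma unit_lower_bound_le p y : 0 <= y <= 1 -> IZR (unit_lower_bound p) <= peval p y.
Proof.
  intros Hy.
  assert (H : forall q, IZR (fold_right (fun a m => Z.min 0 a + m)%Z 0%Z q) <= 0 /\
    IZR (fold_right (fun a m => Z.min 0 a + m)%Z 0%Z q) <= y * peval q y).
  { induction q as [|a q [IH0 IH]]; simpl; [lra |].
    rewrite plus_IZR.
    assert (Ha : IZR (Z.min 0 a) <= 0) by (apply IZR_le; lia).
    assert (Ha' : IZR (Z.min 0 a) <= IZR a) by (apply IZR_le; lia).
    split; [lra |]. nra. }
  destruct p as [|c q]; simpl; [lra |]. rewrite plus_IZR. destruct (H q). lra.
Qed.

Lemma positive_steps_spec n p y :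
  positive_steps n p = true -> 0 <= y <= INR n -> (0 < n)%nat -> 0 < peval p y.
Proof.
  revert p y. induction n as [|n IH]; intros p y H Hy Hn; [lia |].
  simpl positive_steps in H. apply andb_prop in H. destruct H as [H1 H2].
  apply Z.ltb_lt in H1. destruct (Rle_dec y 1) as [Hy1 | Hy1].
  - apply Rlt_le_trans with (IZR (unit_lower_bound p)); [now apply IZR_lt | apply unit_lower_bound_le; lra].
  - rewrite S_INR in Hy. destruct n as [|n]; [simpl in Hy; lra |].
    replace y with ((y - 1) + 1) by ring. rewrite <- peval_taylor_shift.
    apply IH; [assumption | lra | lia].
Qed.

Theorem positive_on_spec k a n p x :
  positive_on k a n p = true -> (0 < k)%Z -> (0 < n)%nat ->
  INR a <= IZR k * x <= INR a + INR n -> 0 < peval p x.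
Proof.
  intros H Hk Hn Hx. apply IZR_lt in Hk.
  assert (Hp : 0 < peval (dilate k p) (IZR k * x)).
  { replace (IZR k * x) with ((IZR k * x - INR a) + INR a) by ring.
    rewrite <- peval_taylor_shift_iter. apply positive_steps_spec with n; [assumption | lra | lia]. }
  assert (Hm : 0 < IZR k ^ length p * peval p x).
  { rewrite <- peval_dilate. now apply Rmult_lt_0_compat. }
  apply Rmult_lt_reg_l with (IZR k ^ length p); [now apply pow_lt | lra].
Qed.

(** * Comparison of radial profiles *)

(** The cubic radial equation with the mass [e] allowed to vary with [s],
    normalized by the value [6] at the origin. *)
Record profile (e : R -> R) (b : R) (y y1 : R -> R) : Prop := {
  profile_pos : forall s, 0 < s <= b -> 0 < y s;
  profile_derive : forall s, 0 < s <= b -> is_derive y s (y1 s);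
  profile_eqn : forall s, 0 < s <= b ->
    is_derive y1 s (e s * y s - y s ^ 3 - 2 / s * y1 s);
  profile_origin : near0 1 (fun s => y s - 6);
  profile_origin1 : near0 0 y1 }.

Lemma profile_shrink e b b' y y1 : b' <= b -> profile e b y y1 -> profile e b' y y1.
Proof.
  intros Hb [H1 H2 H3 H4 H5]. split; try assumption; intros s Hs.
  - apply H1; lra.
  - apply H2; lra.
  - apply H3; lra.
Qed.

Lemma profile_bounded e b y y1 : profile e b y y1 -> near0 0 y.
Proof.
  intros H. apply near0_ext with (fun s => (y s - 6) + 6); [intros; ring |].
  apply near0_plus; [| apply near0_const].
  apply (near0_weaken 1); [lia | apply (profile_origin _ _ _ _ H)].
Qed.

(** The inequality is [(s^2 y^2 h')' >= s^2 y^2] with the factor [s^2 y^2] divided out.  To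
    first order, a change [delta] of the mass moves the logarithm of the profile by at most
    [delta * h]. *)
Record gauge (b : R) (y y1 h h1 h2 : R -> R) : Prop := {
  gauge_derive : forall s, 0 < s <= b -> is_derive h s (h1 s);
  gauge_derive2 : forall s, 0 < s <= b -> is_derive h1 s (h2 s);
  gauge_ineq : forall s, 0 < s <= b -> 1 <= h2 s + 2 / s * h1 s + 2 * (y1 s / y s) * h1 s;
  gauge_pos : forall s, 0 < s <= b -> 0 <= h s;
  gauge_origin : near0 1 h;
  gauge_origin1 : near0 0 h1 }.

Lemma gauge_shrink b b' y y1 h h1 h2 : b' <= b -> gauge b y y1 h h1 h2 -> gauge b' y y1 h h1 h2.
Proof.
  intros Hb [H1 H2 H3 H4 H5 H6]. split; try assumption; intros s Hs.
  - apply H1; lra.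
  - apply H2; lra.
  - apply H3; lra.
  - apply H4; lra.
Qed.

Lemma near0_wronskian a a1 c c1 :
  near0 0 a -> near0 0 a1 -> near0 0 c -> near0 0 c1 ->
  near0 2 (fun s => s ^ 2 * (a s * c1 s - a1 s * c s)).
Proof.
  intros Ha Ha1 Hc Hc1. apply (near0_mult 2 0); [apply near0_pow |].
  apply near0_ext with (fun s => a s * c1 s + -1 * (a1 s * c s)); [intros; ring |].
  apply near0_plus; [now apply (near0_mult 0 0) |].
  apply near0_scal. now apply (near0_mult 0 0).
Qed.

Lemma is_derive_wronskian ea ec b a a1 c c1 s :
  profile ea b a a1 -> profile ec b c c1 -> 0 < s <= b ->
  is_derive (fun s => s ^ 2 * (a s * c1 s - a1 s * c s)) s
    (s ^ 2 * (a s * c s) * ((ec s - ea s) - (c s ^ 2 - a s ^ 2))).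
Proof.
  intros Ha Hc Hs.
  pose proof (profile_derive _ _ _ _ Ha s Hs). pose proof (profile_derive _ _ _ _ Hc s Hs).
  pose proof (profile_eqn _ _ _ _ Ha s Hs). pose proof (profile_eqn _ _ _ _ Hc s Hs).
  derive. field. lra.
Qed.

(** Sturm comparison: [(s^2 W)' = s^2 a c ((ec - ea) - (c^2 - a^2))] for the Wronskian [W], so
    the order persists as long as the gap of the squares has not used up the gap of the
    masses. *)
Lemma sturm_comparison ea ec b a a1 c c1 :
  profile ea b a a1 -> profile ec b c c1 ->
  (forall s, 0 < s <= b -> c s ^ 2 - a s ^ 2 <= ec s - ea s) ->
  forall s, 0 < s <= b -> 0 <= a s * c1 s - a1 s * c s /\ a s <= c s.
Proof.
  intros Ha Hc Hgap.
  assert (HW : forall s, 0 < s <= b -> 0 <= a s * c1 s - a1 s * c s).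
  { intros s Hs.
    assert (H : 0 <= s ^ 2 * (a s * c1 s - a1 s * c s)).
    { apply nonneg_from_zero with
        (f := fun s => s ^ 2 * (a s * c1 s - a1 s * c s))
        (f' := fun s => s ^ 2 * (a s * c s) * ((ec s - ea s) - (c s ^ 2 - a s ^ 2)))
        (b := b); [| | | assumption].
      - intros t Ht. now apply is_derive_wronskian with b.
      - intros t Ht. specialize (Hgap t Ht).
        pose proof (profile_pos _ _ _ _ Ha t Ht). pose proof (profile_pos _ _ _ _ Hc t Ht).
        apply Rmult_le_pos; [| lra]. apply Rmult_le_pos; [apply pow2_ge_0 |].
        apply Rmult_le_pos; lra.
      - apply (near0_weaken 2); [lia |]. apply near0_wronskian;
        [apply (profile_bounded _ _ _ _ Ha) | apply (profile_origin1 _ _ _ _ Ha)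
        |apply (profile_bounded _ _ _ _ Hc) | apply (profile_origin1 _ _ _ _ Hc)]. }
    apply Rmult_le_reg_l with (s ^ 2); [apply pow_lt; lra | lra]. }
  intros s Hs. split; [now apply HW |].
  assert (H : 0 <= c s / a s - 1).
  { apply nonneg_from_zero with (f := fun s => c s / a s - 1)
      (f' := fun s => (a s * c1 s - a1 s * c s) / a s ^ 2) (b := b); [| | | assumption].
    - intros t Ht. pose proof (profile_pos _ _ _ _ Ha t Ht).
      pose proof (profile_derive _ _ _ _ Ha t Ht). pose proof (profile_derive _ _ _ _ Hc t Ht).
      derive; [lra |]. field. lra.
    - intros t Ht. pose proof (profile_pos _ _ _ _ Ha t Ht).
      apply Rmult_le_pos; [now apply HW |]. left. apply Rinv_0_lt_compat, pow_lt. lra.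
    - assert (Hb : 0 < b) by lra.
      destruct (near0_inv a 6 ltac:(lra) (profile_origin _ _ _ _ Ha)) as (C & d & Hd & HC).
      assert (Hq : near0 1 (fun s => ((c s - 6) + -1 * (a s - 6)) * / a s)).
      { apply (near0_mult 1 0); [| exists C, d; now split].
        apply near0_plus; [| apply near0_scal]; [apply (profile_origin _ _ _ _ Hc) |
          apply (profile_origin _ _ _ _ Ha)]. }
      destruct Hq as (C' & d' & Hd' & HC').
      exists C', (Rmin d' b). split; [now apply Rmin_pos |]. intros t Ht.
      pose proof (Rmin_l d' b). pose proof (Rmin_r d' b).
      specialize (HC' t ltac:(lra)). pose proof (profile_pos _ _ _ _ Ha t ltac:(lra)).
      replace (c t / a t - 1) with ((c t - 6 + -1 * (a t - 6)) * / a t) by (field; lra).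
      exact HC'. }
  pose proof (profile_pos _ _ _ _ Ha s Hs).
  assert (0 <= (c s / a s - 1) * a s) by (apply Rmult_le_pos; lra).
  replace ((c s / a s - 1) * a s) with (c s - a s) in H1 by (field; lra). lra.
Qed.

Lemma near0_square_gap ea ec b a a1 c c1 :
  profile ea b a a1 -> profile ec b c c1 -> near0 1 (fun s => c s ^ 2 - a s ^ 2).
Proof.
  intros Ha Hc.
  apply near0_ext with (fun s => ((c s - 6) + -1 * (a s - 6)) * (c s + a s)); [intros; ring |].
  apply (near0_mult 1 0).
  - apply near0_plus; [| apply near0_scal];
      [apply (profile_origin _ _ _ _ Hc) | apply (profile_origin _ _ _ _ Ha)].
  - apply near0_plus; [apply (profile_bounded _ _ _ _ Hc) | apply (profile_bounded _ _ _ _ Ha)].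
Qed.

Lemma continuity_square_gap ea ec b a a1 c c1 s :
  profile ea b a a1 -> profile ec b c c1 -> 0 < s <= b ->
  continuity_pt (fun s => c s ^ 2 - a s ^ 2) s.
Proof.
  intros Ha Hc Hs.
  pose proof (profile_derive _ _ _ _ Ha s Hs). pose proof (profile_derive _ _ _ _ Hc s Hs).
  eapply is_derive_continuity. derive. reflexivity.
Qed.

(** A profile [Y] of smaller mass than the reference [y]: the ratio [m = Y/y]
    satisfies [(s^2 y^2 m')' >= - hi s^2 y^2], hence [m >= 1 - hi h], which keeps
    [y^2 - Y^2] below the mass gap. *)
Lemma square_gap_below e eps lo hi b Y Y1 y y1 h h1 h2 :
  profile (fun _ => eps) b Y Y1 -> profile e b y y1 -> gauge b y y1 h h1 h2 ->
  0 < lo -> (forall s, 0 < s <= b -> lo <= e s - eps <= hi) ->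
  (forall s, 0 < s <= b -> 2 * y s ^ 2 * (hi * h s) < lo) ->
  forall s, 0 < s <= b -> y s ^ 2 - Y s ^ 2 < lo.
Proof.
  intros HY Hy Hh Hlo He Hsmall.
  apply bootstrap; [| now apply near0_square_gap with (fun _ => eps) e b Y1 y1 | assumption |].
  { intros s Hs. now apply continuity_square_gap with (fun _ => eps) e b Y1 y1. }
  intros t Ht Hgap.
  assert (HY' := profile_shrink _ b t _ _ ltac:(lra) HY).
  assert (Hy' := profile_shrink _ b t _ _ ltac:(lra) Hy).
  assert (Hord := sturm_comparison (fun _ => eps) e t Y Y1 y y1 HY' Hy'
    ltac:(intros s Hs; specialize (Hgap s Hs); specialize (He s ltac:(lra)); lra)).
  assert (Hhi : 0 < hi) by (specialize (He t ltac:(lra)); lra).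
  assert (Hf : forall s, 0 < s <= t ->
    0 <= hi * (s ^ 2 * (y s ^ 2 * h1 s)) - s ^ 2 * (Y s * y1 s - Y1 s * y s)).
  { apply nonneg_from_zero with (f' := fun s =>
      hi * (s ^ 2 * y s ^ 2 * (h2 s + 2 / s * h1 s + 2 * (y1 s / y s) * h1 s))
      - s ^ 2 * (Y s * y s) * ((e s - eps) - (y s ^ 2 - Y s ^ 2))).
    - intros s Hs. assert (Hsb : 0 < s <= b) by lra.
      pose proof (profile_pos _ _ _ _ Hy s Hsb).
      pose proof (profile_derive _ _ _ _ Hy s Hsb).
      pose proof (gauge_derive2 _ _ _ _ _ _ Hh s Hsb).
      apply (derive_minus (fun s => hi * (s ^ 2 * (y s ^ 2 * h1 s)))).
      + derive. field. lra.
      + apply (is_derive_wronskian (fun _ => eps) e b); assumption.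
    - intros s Hs. assert (Hsb : 0 < s <= b) by lra.
      pose proof (gauge_ineq _ _ _ _ _ _ Hh s Hsb).
      pose proof (profile_pos _ _ _ _ Hy s Hsb). pose proof (profile_pos _ _ _ _ HY s Hsb).
      destruct (Hord s Hs) as [_ HYy]. specialize (He s Hsb).
      assert (Hs2 : 0 < s ^ 2) by (apply pow_lt; lra).
      assert (Y s ^ 2 <= y s ^ 2) by (apply pow_incr; lra).
      assert (H3 : (Y s * y s) * ((e s - eps) - (y s ^ 2 - Y s ^ 2)) <= y s ^ 2 * hi).
      { apply Rle_trans with ((Y s * y s) * hi).
        - apply Rmult_le_compat_l; [apply Rmult_le_pos; lra | lra].
        - apply Rmult_le_compat_r; [lra |]. simpl. rewrite Rmult_1_r.
          apply Rmult_le_compat_r; lra. }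
      set (A := h2 s + _ + _) in *.
      assert (H4 : hi * y s ^ 2 <= hi * (y s ^ 2 * A)).
      { apply Rmult_le_compat_l; [lra |]. rewrite <- (Rmult_1_r (y s ^ 2)) at 1.
        apply Rmult_le_compat_l; [apply pow2_ge_0 | assumption]. }
      replace (_ - _) with (s ^ 2 * (hi * (y s ^ 2 * A)
        - (Y s * y s) * ((e s - eps) - (y s ^ 2 - Y s ^ 2)))) by ring.
      apply Rmult_le_pos; lra.
    - apply (near0_weaken 2); [lia |].
      apply near0_ext with (fun s => hi * (s ^ 2 * (y s ^ 2 * h1 s))
         + -1 * (s ^ 2 * (Y s * y1 s - Y1 s * y s))); [intros; ring |].
      pose proof (profile_bounded _ _ _ _ Hy). pose proof (profile_bounded _ _ _ _ HY).
      apply near0_plus; apply near0_scal.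
      + apply (near0_mult 2 0); [apply near0_pow |].
        apply (near0_mult 0 0); [| apply (gauge_origin1 _ _ _ _ _ _ Hh)].
        apply near0_ext with (fun s => y s * y s); [intros; ring |].
        now apply (near0_mult 0 0).
      + apply near0_wronskian; try assumption;
          [apply (profile_origin1 _ _ _ _ HY) | apply (profile_origin1 _ _ _ _ Hy)]. }
  assert (Hm : 0 <= Y t / y t + hi * h t - 1).
  { apply nonneg_from_zero with (f := fun s => Y s / y s + hi * h s - 1)
      (f' := fun s => (hi * (s ^ 2 * (y s ^ 2 * h1 s)) - s ^ 2 * (Y s * y1 s - Y1 s * y s))
                      / (s ^ 2 * y s ^ 2)) (b := t); [| | | lra].
    - intros s Hs. assert (Hsb : 0 < s <= b) by lra.
      pose proof (profile_pos _ _ _ _ Hy s Hsb).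
      pose proof (profile_derive _ _ _ _ Hy s Hsb). pose proof (profile_derive _ _ _ _ HY s Hsb).
      pose proof (gauge_derive _ _ _ _ _ _ Hh s Hsb).
      derive; [lra |]. field. lra.
    - intros s Hs. pose proof (profile_pos _ _ _ _ Hy s ltac:(lra)).
      apply Rmult_le_pos; [now apply Hf |]. left.
      apply Rinv_0_lt_compat, Rmult_lt_0_compat; apply pow_lt; lra.
    - destruct (near0_inv y 6 ltac:(lra) (profile_origin _ _ _ _ Hy)) as (C & d & Hd & HC).
      assert (Hq : near0 1 (fun s => ((Y s - 6) + -1 * (y s - 6)) * / y s + hi * h s)).
      { apply near0_plus; [| apply near0_scal, (gauge_origin _ _ _ _ _ _ Hh)].
        apply (near0_mult 1 0); [| exists C, d; now split].
        apply near0_plus; [| apply near0_scal]; [apply (profile_origin _ _ _ _ HY) |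
          apply (profile_origin _ _ _ _ Hy)]. }
      destruct Hq as (C' & d' & Hd' & HC').
      exists C', (Rmin d' b). split; [apply Rmin_pos; lra |]. intros s Hs.
      pose proof (Rmin_l d' b). pose proof (Rmin_r d' b).
      specialize (HC' s ltac:(lra)). pose proof (profile_pos _ _ _ _ Hy s ltac:(lra)).
      replace (Y s / y s + hi * h s - 1)
        with ((Y s - 6 + -1 * (y s - 6)) * / y s + hi * h s) by (field; lra).
      exact HC'. }
  destruct (Hord t ltac:(lra)) as [_ HYy].
  pose proof (profile_pos _ _ _ _ Hy t Ht). pose proof (profile_pos _ _ _ _ HY t Ht).
  specialize (Hsmall t Ht).
  assert (Hm' : y t - Y t <= hi * h t * y t).
  { assert (0 <= (Y t / y t + hi * h t - 1) * y t) by (apply Rmult_le_pos; lra).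
    replace ((Y t / y t + hi * h t - 1) * y t) with (Y t + hi * h t * y t - y t) in H1
      by (field; lra). lra. }
  assert (Hprod : (y t - Y t) * (y t + Y t) <= hi * h t * y t * (2 * y t))
    by (apply Rmult_le_compat; lra).
  replace (hi * h t * y t * (2 * y t)) with (2 * y t ^ 2 * (hi * h t)) in Hprod by ring.
  replace (y t ^ 2 - Y t ^ 2) with ((y t - Y t) * (y t + Y t)) by ring. lra.
Qed.

(** A profile [Y] of larger mass than the reference [y]: here the logarithmic
    derivative of [Y/y] is at most [hi h'], and a bound for the square of the ratio is
    [(1 + hi h)/(1 - hi h)], which dominates [exp (2 hi h)]. *)
Lemma square_gap_above e eps lo hi b Y Y1 y y1 h h1 h2 :
  profile (fun _ => eps) b Y Y1 -> profile e b y y1 -> gauge b y y1 h h1 h2 ->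
  0 < lo -> (forall s, 0 < s <= b -> lo <= eps - e s <= hi) ->
  (forall s, 0 < s <= b -> hi * h s < 1) ->
  (forall s, 0 < s <= b -> 2 * y s ^ 2 * (hi * h s) < lo * (1 - hi * h s)) ->
  forall s, 0 < s <= b -> Y s ^ 2 - y s ^ 2 < lo.
Proof.
  intros HY Hy Hh Hlo He Hone Hsmall.
  apply bootstrap; [| now apply near0_square_gap with e (fun _ => eps) b y1 Y1 | assumption |].
  { intros s Hs. now apply continuity_square_gap with e (fun _ => eps) b y1 Y1. }
  intros t Ht Hgap.
  assert (HY' := profile_shrink _ b t _ _ ltac:(lra) HY).
  assert (Hy' := profile_shrink _ b t _ _ ltac:(lra) Hy).
  assert (Hord := sturm_comparison e (fun _ => eps) t y y1 Y Y1 Hy' HY'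
    ltac:(intros s Hs; specialize (Hgap s Hs); specialize (He s ltac:(lra)); lra)).
  assert (Hhi : 0 < hi) by (specialize (He t ltac:(lra)); lra).
  pose proof (profile_bounded _ _ _ _ Hy) as By. pose proof (profile_bounded _ _ _ _ HY) as BY.
  assert (IY : near0 0 (fun s => / Y s))
    by (apply near0_inv with 6; [lra | apply (profile_origin _ _ _ _ HY)]).
  assert (Iy : near0 0 (fun s => / y s))
    by (apply near0_inv with 6; [lra | apply (profile_origin _ _ _ _ Hy)]).
  assert (Hf : forall s, 0 < s <= t ->
    0 <= hi * (s ^ 2 * (y s ^ 2 * h1 s)) - s ^ 2 * (y s * Y1 s - y1 s * Y s) * (y s / Y s)).
  { apply nonneg_from_zero with (f' := fun s =>
      hi * (s ^ 2 * y s ^ 2 * (h2 s + 2 / s * h1 s + 2 * (y1 s / y s) * h1 s))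
      - (s ^ 2 * y s ^ 2 * ((eps - e s) - (Y s ^ 2 - y s ^ 2))
         - s ^ 2 * ((y s * Y1 s - y1 s * Y s) / Y s) ^ 2)).
    - intros s Hs. assert (Hsb : 0 < s <= b) by lra.
      pose proof (profile_pos _ _ _ _ Hy s Hsb). pose proof (profile_pos _ _ _ _ HY s Hsb).
      pose proof (profile_derive _ _ _ _ Hy s Hsb). pose proof (profile_derive _ _ _ _ HY s Hsb).
      pose proof (gauge_derive2 _ _ _ _ _ _ Hh s Hsb).
      pose proof (is_derive_wronskian e (fun _ => eps) b y y1 Y Y1 s Hy HY Hsb) as HW.
      apply (derive_minus (fun s => hi * (s ^ 2 * (y s ^ 2 * h1 s)))).
      + derive. field. lra.
      + eapply is_derive_to.
        * apply (derive_mult (fun s => s ^ 2 * (y s * Y1 s - y1 s * Y s)) (fun s => y s / Y s));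
            [exact HW |]. apply derive_div; [eassumption | eassumption | lra].
        * simpl. field. lra.
    - intros s Hs. assert (Hsb : 0 < s <= b) by lra.
      pose proof (gauge_ineq _ _ _ _ _ _ Hh s Hsb).
      destruct (Hord s Hs) as [_ HYy]. specialize (He s Hsb).
      pose proof (profile_pos _ _ _ _ Hy s Hsb).
      assert (y s ^ 2 <= Y s ^ 2) by (apply pow_incr; lra).
      assert (Hs2 : 0 <= s ^ 2) by (apply pow_le; lra).
      set (A := h2 s + _ + _) in *. set (q := (_ / Y s)).
      replace (_ - _) with (s ^ 2 * (y s ^ 2 * (hi * (A - 1)
         + (hi - (eps - e s)) + (Y s ^ 2 - y s ^ 2)) + q ^ 2)) by ring.
      apply Rmult_le_pos; [assumption |].
      apply Rplus_le_le_0_compat; [| apply pow2_ge_0].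
      apply Rmult_le_pos; [apply pow2_ge_0 |].
      assert (0 <= hi * (A - 1)) by (apply Rmult_le_pos; lra). lra.
    - apply (near0_weaken 2); [lia |].
      apply near0_ext with (fun s => hi * (s ^ 2 * ((y s * y s) * h1 s))
         + -1 * (s ^ 2 * (y s * Y1 s - y1 s * Y s) * (y s * / Y s)));
        [intros; unfold Rdiv; ring |].
      apply near0_plus; apply near0_scal.
      + apply (near0_mult 2 0); [apply near0_pow |].
        apply (near0_mult 0 0); [now apply (near0_mult 0 0) | apply (gauge_origin1 _ _ _ _ _ _ Hh)].
      + apply (near0_mult 2 0); [| now apply (near0_mult 0 0)].
        apply near0_wronskian; try assumption;
          [apply (profile_origin1 _ _ _ _ Hy) | apply (profile_origin1 _ _ _ _ HY)]. }
  assert (Hm : 0 <= 1 - (Y t / y t) ^ 2 * ((1 - hi * h t) / (1 + hi * h t))).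
  { apply nonneg_from_zero with
      (f := fun s => 1 - (Y s / y s) ^ 2 * ((1 - hi * h s) / (1 + hi * h s)))
      (f' := fun s => 2 * (Y s / y s) ^ 2 / (1 + hi * h s) ^ 2 *
        ((hi * (s ^ 2 * (y s ^ 2 * h1 s)) - s ^ 2 * (y s * Y1 s - y1 s * Y s) * (y s / Y s))
            / (s ^ 2 * y s ^ 2)
         + (hi * h s) ^ 2 * ((y s * Y1 s - y1 s * Y s) / (Y s * y s))))
      (b := t); [| | | lra].
    - intros s Hs. assert (Hsb : 0 < s <= b) by lra.
      pose proof (profile_pos _ _ _ _ Hy s Hsb). pose proof (profile_pos _ _ _ _ HY s Hsb).
      pose proof (profile_derive _ _ _ _ Hy s Hsb). pose proof (profile_derive _ _ _ _ HY s Hsb).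
      pose proof (gauge_derive _ _ _ _ _ _ Hh s Hsb).
      pose proof (gauge_pos _ _ _ _ _ _ Hh s Hsb).
      assert (0 <= hi * h s) by (apply Rmult_le_pos; lra).
      derive; [lra | lra |]. field. lra.
    - intros s Hs. assert (Hsb : 0 < s <= b) by lra.
      pose proof (profile_pos _ _ _ _ Hy s Hsb). pose proof (profile_pos _ _ _ _ HY s Hsb).
      pose proof (gauge_pos _ _ _ _ _ _ Hh s Hsb).
      assert (0 <= hi * h s) by (apply Rmult_le_pos; lra).
      apply Rmult_le_pos.
      + apply Rmult_le_pos; [| left; apply Rinv_0_lt_compat, pow_lt; lra].
        apply Rmult_le_pos; [lra | apply pow2_ge_0].
      + apply Rplus_le_le_0_compat.
        * apply Rmult_le_pos; [now apply Hf |]. left.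
          apply Rinv_0_lt_compat, Rmult_lt_0_compat; apply pow_lt; lra.
        * apply Rmult_le_pos; [apply pow2_ge_0 |].
          apply Rmult_le_pos; [apply Hord; lra |]. left.
          apply Rinv_0_lt_compat, Rmult_lt_0_compat; lra.
    - assert (Hh0 : near0 1 (fun s => hi * h s))
        by apply near0_scal, (gauge_origin _ _ _ _ _ _ Hh).
      assert (Ih : near0 0 (fun s => / (1 + hi * h s))).
      { apply near0_inv with 1; [lra |].
        apply near0_ext with (fun s => hi * h s); [intros; ring | assumption]. }
      assert (Hg := near0_square_gap (fun _ => eps) e b Y Y1 y y1 HY Hy).
      assert (Hq : near0 1 (fun s => (y s ^ 2 - Y s ^ 2) * (/ y s * / y s)
         + 2 * (hi * h s * ((Y s * Y s * (/ y s * / y s)) * / (1 + hi * h s))))).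
      { apply near0_plus.
        - apply (near0_mult 1 0); [assumption | now apply (near0_mult 0 0)].
        - apply near0_scal. apply (near0_mult 1 0); [assumption |].
          apply (near0_mult 0 0); [| assumption].
          apply (near0_mult 0 0); now apply (near0_mult 0 0). }
      destruct Hq as (C' & d' & Hd' & HC').
      exists C', (Rmin d' b). split; [apply Rmin_pos; lra |]. intros s Hs.
      pose proof (Rmin_l d' b). pose proof (Rmin_r d' b).
      specialize (HC' s ltac:(lra)). pose proof (profile_pos _ _ _ _ Hy s ltac:(lra)).
      assert (0 <= hi * h s)
        by (apply Rmult_le_pos; [lra | apply (gauge_pos _ _ _ _ _ _ Hh); lra]).
      match goal with |- Rabs ?u <= _ => match type of HC' with Rabs ?w <= _ =>
        replace u with w by (field; lra) end end.
      exact HC'. }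
  specialize (Hsmall t Ht). specialize (Hone t Ht).
  pose proof (profile_pos _ _ _ _ Hy t Ht).
  assert (Hht : 0 <= hi * h t)
    by (apply Rmult_le_pos; [lra | apply (gauge_pos _ _ _ _ _ _ Hh); lra]).
  set (x := hi * h t) in *.
  assert (Hm' : Y t ^ 2 * (1 - x) <= y t ^ 2 * (1 + x)).
  { assert (0 <= (1 - (Y t / y t) ^ 2 * ((1 - x) / (1 + x))) * (y t ^ 2 * (1 + x))).
    { apply Rmult_le_pos; [assumption |]. apply Rmult_le_pos; [apply pow2_ge_0 | lra]. }
    replace (_ * _) with (y t ^ 2 * (1 + x) - Y t ^ 2 * (1 - x)) in H0 by (field; lra). lra. }
  apply Rmult_lt_reg_r with (1 - x); lra.
Qed.

(** * A priori properties of the ground state *)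

(** [Y s = c Q (c s)] with [c = 6 / Q 0] turns the ground state into such a [Y], with
    [eps = c^2]. *)
Record rescaled_ground_state (eps : R) (Y Y1 : R -> R) : Prop := {
  rgs_eps : 0 < eps;
  rgs_profile : forall b, profile (fun _ => eps) b Y Y1;
  rgs_decay : forall eta, 0 < eta -> exists s0, 0 < s0 /\ forall s, s0 <= s -> Y s < eta }.

Section GroundState.
Variables (eps : R) (Y Y1 : R -> R).
Hypothesis HY : rescaled_ground_state eps Y Y1.

Let q s := s * Y s.
Let p s := Y s + s * Y1 s.

Lemma rgs_pos s : 0 < s -> 0 < Y s.
Proof. intros Hs. apply (profile_pos _ s _ _ (rgs_profile _ _ _ HY s)). lra. Qed.

Lemma rgs_derive s : 0 < s -> is_derive Y s (Y1 s).
Proof. intros Hs. apply (profile_derive _ s _ _ (rgs_profile _ _ _ HY s)). lra. Qed.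

Lemma rgs_eqn s : 0 < s -> is_derive Y1 s (eps * Y s - Y s ^ 3 - 2 / s * Y1 s).
Proof. intros Hs. apply (profile_eqn _ s _ _ (rgs_profile _ _ _ HY s)). lra. Qed.

Lemma rgs_q_pos s : 0 < s -> 0 < q s.
Proof. intros Hs. apply Rmult_lt_0_compat; [assumption | now apply rgs_pos]. Qed.

Lemma rgs_q_derive s : 0 < s -> is_derive q s (p s).
Proof.
  intros Hs. pose proof (rgs_derive s Hs). unfold q, p. derive. ring.
Qed.

Lemma rgs_p_derive s : 0 < s -> is_derive p s ((eps - Y s ^ 2) * q s).
Proof.
  intros Hs. pose proof (rgs_derive s Hs). pose proof (rgs_eqn s Hs).
  unfold q, p. derive. field. lra.
Qed.

(** Far out [q = s Y] is convex and [o(s)], so its slope [p] cannot become positive. *)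
Lemma rgs_far : exists s0, 0 < s0 /\ forall s, s0 <= s -> p s <= 0 /\ Y s ^ 2 <= eps / 2.
Proof.
  pose proof (rgs_eps _ _ _ HY) as He.
  destruct (rgs_decay _ _ _ HY (Rmin 1 (eps / 2))) as (s0 & Hs0 & Hd).
  { apply Rmin_pos; lra. }
  assert (HY2 : forall s, s0 <= s -> Y s ^ 2 <= eps / 2).
  { intros s Hs. specialize (Hd s Hs). pose proof (rgs_pos s ltac:(lra)).
    pose proof (Rmin_l 1 (eps / 2)). pose proof (Rmin_r 1 (eps / 2)). nra. }
  exists s0. split; [assumption |]. intros s Hs. split; [| now apply HY2].
  destruct (Rle_dec (p s) 0) as [|Hn]; [assumption | exfalso].
  destruct (rgs_decay _ _ _ HY (p s / 2) ltac:(lra)) as (s1 & Hs1 & Hd1).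
  set (t := Rmax s1 (2 * s)).
  assert (s1 <= t) by apply Rmax_l. assert (2 * s <= t) by apply Rmax_r.
  assert (Hconv : forall u, s <= u -> p s <= p u).
  { intros u Hu. apply nondecreasing_of_derive with (fun u => (eps - Y u ^ 2) * q u); [assumption | |].
    - intros x Hx. apply rgs_p_derive. lra.
    - intros x Hx. specialize (HY2 x ltac:(lra)). pose proof (rgs_q_pos x ltac:(lra)).
      apply Rmult_le_pos; lra. }
  assert (Hlin : q s - p s * s <= q t - p s * t).
  { apply nondecreasing_of_derive with (f := fun u => q u - p s * u) (f' := fun u => p u - p s);
      [lra | |].
    - intros x Hx. pose proof (rgs_q_derive x ltac:(lra)). derive. ring.
    - intros x Hx. specialize (Hconv x ltac:(lra)). lra. }
  specialize (Hd1 t ltac:(lra)). pose proof (rgs_q_pos s ltac:(lra)).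
  assert (q t < p s / 2 * t).
  { unfold q. rewrite Rmult_comm. apply Rmult_lt_compat_r; lra. }
  nra.
Qed.

(** Nor can [q] stay away from [0], since [q'' >= eps q / 2] would then make the slope positive. *)
Lemma rgs_q_decay eta : 0 < eta -> exists s0, 0 < s0 /\ forall s, s0 <= s -> q s < eta.
Proof.
  intros Heta. pose proof (rgs_eps _ _ _ HY) as He.
  destruct rgs_far as (s0 & Hs0 & Hfar).
  assert (Hdec : forall a b, s0 <= a -> a <= b -> q b <= q a).
  { intros a b Ha Hab.
    assert (- q a <= - q b); [| lra].
    apply nondecreasing_of_derive with (f := fun u => - q u) (f' := fun u => - p u);
      [assumption | |].
    - intros x Hx. pose proof (rgs_q_derive x ltac:(lra)). derive. ring.
    - intros x Hx. destruct (Hfar x ltac:(lra)). lra. }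
  assert (Hex : exists s1, s0 <= s1 /\ q s1 < eta).
  { set (s1 := s0 + (- p s0 + 1) / (eps / 2 * eta)).
    destruct (Hfar s0 ltac:(lra)) as [Hp0 _].
    assert (Hc : 0 < eps / 2 * eta) by (apply Rmult_lt_0_compat; lra).
    assert (Hs1 : s0 < s1).
    { unfold s1. assert (0 < (- p s0 + 1) / (eps / 2 * eta)); [| lra].
      apply Rdiv_lt_0_compat; lra. }
    exists s1. split; [lra |].
    destruct (Rlt_dec (q s1) eta) as [|Hn]; [assumption | exfalso].
    assert (p s0 - eps / 2 * eta * s0 <= p s1 - eps / 2 * eta * s1).
    { apply nondecreasing_of_derive with (f := fun u => p u - eps / 2 * eta * u)
        (f' := fun u => (eps - Y u ^ 2) * q u - eps / 2 * eta); [lra | |].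
      - intros x Hx. pose proof (rgs_p_derive x ltac:(lra)). derive. ring.
      - intros x Hx. destruct (Hfar x ltac:(lra)) as [_ H2].
        specialize (Hdec x s1 ltac:(lra) ltac:(lra)).
        assert (eps / 2 * eta <= (eps - Y x ^ 2) * q x); [| lra].
        apply Rmult_le_compat; lra. }
    assert (eps / 2 * eta * (s1 - s0) = - p s0 + 1).
    { unfold s1. field. split; lra. }
    destruct (Hfar s1 ltac:(lra)). lra. }
  destruct Hex as (s1 & Hs1 & Hq). exists s1. split; [lra |].
  intros s Hs. apply Rle_lt_trans with (q s1); [now apply Hdec | assumption].
Qed.

(** This quantity has the derivative [- q^4 / s^3], and its only negative term is [- eps q^2],
    which tends to [0]. *)
Lemma rgs_energy_pos s : 0 < s -> 0 < p s ^ 2 - eps * q s ^ 2 + q s ^ 4 / (2 * s ^ 2).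
Proof.
  intros Hs. pose proof (rgs_eps _ _ _ HY) as He.
  set (G := fun s => p s ^ 2 - eps * q s ^ 2 + q s ^ 4 / (2 * s ^ 2)).
  change (0 < G s).
  assert (Hdec : forall a b, 0 < a -> a < b -> G b < G a).
  { intros a b Ha Hab. assert (- G a < - G b); [| lra].
    apply increasing_of_derive with (f := fun u => - G u) (f' := fun u => q u ^ 4 / u ^ 3);
      [assumption | |].
    - intros x Hx. pose proof (rgs_q_derive x ltac:(lra)). pose proof (rgs_p_derive x ltac:(lra)).
      unfold G. derive; [apply Rgt_not_eq, Rmult_lt_0_compat; [lra | apply pow_lt; lra] |].
      unfold q. field. lra.
    - intros x Hx. pose proof (rgs_q_pos x ltac:(lra)).
      apply Rdiv_lt_0_compat; apply pow_lt; lra. }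
  apply Rle_lt_trans with (G (s + 1)); [| apply Hdec; lra].
  destruct (Rle_dec 0 (G (s + 1))) as [|Hn]; [assumption | exfalso].
  set (c := - G (s + 1)). assert (Hc : 0 < c) by (unfold c; lra).
  destruct (rgs_q_decay (Rmin 1 (c / eps))) as (s0 & Hs0 & Hd).
  { apply Rmin_pos; [lra | now apply Rdiv_lt_0_compat]. }
  set (t := Rmax s0 (s + 2)).
  assert (s0 <= t) by apply Rmax_l. assert (s + 2 <= t) by apply Rmax_r.
  assert (G t < - c) by (unfold c; rewrite Ropp_involutive; apply Hdec; lra).
  specialize (Hd t ltac:(lra)). pose proof (rgs_q_pos t ltac:(lra)).
  pose proof (Rmin_l 1 (c / eps)). pose proof (Rmin_r 1 (c / eps)).
  assert (eps * q t < c).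
  { assert (Hlt : q t < c / eps) by lra.
    apply Rmult_lt_compat_l with (r := eps) in Hlt; [| assumption].
    replace (eps * (c / eps)) with c in Hlt by (field; lra). assumption. }
  assert (0 <= p t ^ 2) by apply pow2_ge_0.
  assert (0 <= q t ^ 4 / (2 * t ^ 2)).
  { apply Rmult_le_pos; [apply pow_le; lra |]. left. apply Rinv_0_lt_compat.
    apply Rmult_lt_0_compat; [lra | apply pow_lt; lra]. }
  unfold G in H1. nra.
Qed.

Lemma rgs_log_slope_energy s : 0 < s -> eps - Y s ^ 2 / 2 < (p s / q s) ^ 2.
Proof.
  intros Hs. pose proof (rgs_energy_pos s Hs) as HG. pose proof (rgs_q_pos s Hs) as Hq.
  apply Rmult_lt_reg_r with (q s ^ 2); [now apply pow_lt |].
  replace ((p s / q s) ^ 2 * q s ^ 2) with (p s ^ 2) by (field; lra).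
  replace (q s ^ 4 / (2 * s ^ 2)) with (q s ^ 2 * Y s ^ 2 / 2) in HG by (unfold q; field; lra).
  lra.
Qed.

(** The Riccati equation [rho' = eps - Y^2 - rho^2] for [rho = p / q] and the previous bound
    give [rho' < - Y^2 / 2]. *)
Lemma rgs_log_slope_decreasing a b : 0 < a -> a <= b -> p b / q b <= p a / q a.
Proof.
  intros Ha Hab. assert (- (p a / q a) <= - (p b / q b)); [| lra].
  apply nondecreasing_of_derive with (f := fun s => - (p s / q s))
    (f' := fun s => (p s / q s) ^ 2 - (eps - Y s ^ 2)); [assumption | |].
  - intros x Hx. pose proof (rgs_q_pos x ltac:(lra)).
    pose proof (rgs_q_derive x ltac:(lra)). pose proof (rgs_p_derive x ltac:(lra)).
    derive; [lra |]. field. lra.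
  - intros x Hx. pose proof (rgs_log_slope_energy x ltac:(lra)).
    pose proof (pow2_ge_0 (Y x)). lra.
Qed.

(** The mechanical energy decreases along the flow; it is positive because it dominates the
    positive quantity above wherever [p <= 0]. *)
Lemma rgs_mechanical_energy_pos s :
  0 < s -> 0 < Y1 s ^ 2 - eps * Y s ^ 2 + Y s ^ 4 / 2.
Proof.
  intros Hs. set (E := fun s => Y1 s ^ 2 - eps * Y s ^ 2 + Y s ^ 4 / 2).
  change (0 < E s).
  destruct rgs_far as (s0 & Hs0 & Hfar).
  set (t := Rmax s0 s). assert (s0 <= t) by apply Rmax_l. assert (s <= t) by apply Rmax_r.
  assert (Hdec : E t <= E s).
  { assert (- E s <= - E t); [| lra].
    apply nondecreasing_of_derive with (f := fun u => - E u) (f' := fun u => 4 / u * Y1 u ^ 2);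
      [assumption | |].
    - intros x Hx. pose proof (rgs_derive x ltac:(lra)). pose proof (rgs_eqn x ltac:(lra)).
      unfold E. derive; [lra |]. field. lra.
    - intros x Hx. apply Rmult_le_pos; [| apply pow2_ge_0].
      apply Rmult_le_pos; [lra |]. left. apply Rinv_0_lt_compat. lra. }
  apply Rlt_le_trans with (E t); [| assumption].
  destruct (Hfar t ltac:(lra)) as [Hp _].
  pose proof (rgs_energy_pos t ltac:(lra)) as HG. pose proof (rgs_pos t ltac:(lra)) as Hpos.
  assert (Heq : t ^ 2 * E t = (p t ^ 2 - eps * q t ^ 2 + q t ^ 4 / (2 * t ^ 2))
                - 2 * (p t * Y t) + Y t ^ 2) by (unfold E, p, q; field; lra).
  assert (0 <= Y t ^ 2) by apply pow2_ge_0.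
  assert (p t * Y t <= 0) by nra.
  apply Rmult_lt_reg_l with (t ^ 2); [apply pow_lt; lra | lra].
Qed.

Lemma rgs_slope_origin : near0 1 Y1.
Proof.
  pose proof (rgs_profile _ _ _ HY 1) as HP.
  pose proof (profile_bounded _ _ _ _ HP) as HB.
  assert (HF : near0 0 (fun s => Y s * (eps - Y s ^ 2))).
  { apply (near0_mult 0 0); [assumption |].
    apply near0_ext with (fun s => eps + -1 * (Y s * Y s)); [intros; ring |].
    apply near0_plus; [apply near0_const |]. apply near0_scal. now apply (near0_mult 0 0). }
  destruct HF as (C & d & Hd & HC). exists (C / 3), d. split; [assumption |].
  intros s Hs.
  assert (Hgen : forall sg, sg = 1 \/ sg = -1 -> 0 <= C / 3 * s ^ 3 + sg * (s ^ 2 * Y1 s)).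
  { intros sg Hsg.
    apply nonneg_from_zero with (f := fun s => C / 3 * s ^ 3 + sg * (s ^ 2 * Y1 s))
      (f' := fun s => s ^ 2 * (C + sg * (Y s * (eps - Y s ^ 2)))) (b := s); [| | | lra].
    - intros x Hx. pose proof (rgs_eqn x ltac:(lra)). derive. field. lra.
    - intros x Hx. specialize (HC x ltac:(lra)). simpl in HC. rewrite Rmult_1_r in HC.
      apply Rabs_le_between in HC.
      apply Rmult_le_pos; [apply pow2_ge_0 |]. destruct Hsg as [-> | ->]; lra.
    - apply (near0_weaken 2); [lia |]. apply near0_plus; apply near0_scal.
      + apply (near0_weaken 3); [lia | apply near0_pow].
      + apply (near0_mult 2 0); [apply near0_pow | apply (profile_origin1 _ _ _ _ HP)]. }
  pose proof (Hgen 1 (or_introl eq_refl)). pose proof (Hgen (-1) (or_intror eq_refl)).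
  assert (Hs2 : 0 < s ^ 2) by (apply pow_lt; lra).
  apply Rabs_le_between. simpl (s ^ 1). rewrite Rmult_1_r.
  split; apply Rmult_le_reg_l with (s ^ 2); try assumption; nra.
Qed.

(** At the origin the mechanical energy is [648 - 36 eps]. *)
Lemma rgs_eps_le : eps <= 18.
Proof.
  set (E := fun s => Y1 s ^ 2 - eps * Y s ^ 2 + Y s ^ 4 / 2).
  assert (H0 : near0 1 (fun s => E s - (648 - 36 * eps))).
  { pose proof (rgs_profile _ _ _ HY 1) as HP.
    pose proof (profile_bounded _ _ _ _ HP) as HB.
    apply near0_ext with (fun s => Y1 s * Y1 s
       + (Y s - 6) * (/ 2 * ((Y s + 6) * (Y s * Y s + 36)) + - eps * (Y s + 6))).
    { intros s Hs. unfold E. field. }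
    apply near0_plus.
    - apply (near0_mult 1 0); [apply rgs_slope_origin | apply (profile_origin1 _ _ _ _ HP)].
    - apply (near0_mult 1 0); [apply (profile_origin _ _ _ _ HP) |].
      assert (near0 0 (fun s => Y s + 6)) by (apply near0_plus; [assumption | apply near0_const]).
      apply near0_plus; apply near0_scal; [| assumption].
      apply (near0_mult 0 0); [assumption |].
      apply near0_plus; [now apply (near0_mult 0 0) | apply near0_const]. }
  destruct (Rle_dec eps 18) as [|Hn]; [assumption | exfalso].
  destruct (near0_bound 0 _ H0 (36 * (eps - 18)) ltac:(lra)) as (d & Hd & H).
  specialize (H (d / 2) ltac:(lra)). apply Rabs_def2 in H.
  pose proof (rgs_mechanical_energy_pos (d / 2) ltac:(lra)). unfold E in H. lra.
Qed.

(** A first critical point would have [Y^2 > 2 eps] by positivity of the energy, where the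
    equation makes it a maximum, not the end of a decreasing stretch. *)
Lemma rgs_slope_neg s : 0 < s -> Y1 s < 0.
Proof.
  intros Hs. destruct (Rlt_dec (Y1 s) 0) as [|Hn]; [assumption | exfalso].
  assert (Hd : forall x, 0 < x -> is_derive (fun s => s ^ 2 * Y1 s) x (x ^ 2 * (Y x * (eps - Y x ^ 2)))).
  { intros x Hx. pose proof (rgs_eqn x Hx). derive. field. lra. }
  pose proof (rgs_eps_le) as Hle.
  assert (Hstart : exists a, 0 < a < s /\ a ^ 2 * Y1 a < 0).
  { destruct (near0_bound 0 _ (profile_origin _ _ _ _ (rgs_profile _ _ _ HY 1)) 1 ltac:(lra))
      as (d & Hd0 & HC).
    set (a := Rmin (d / 2) (s / 2)).
    assert (0 < a) by (apply Rmin_pos; lra).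
    assert (a <= d / 2) by apply Rmin_l. assert (a <= s / 2) by apply Rmin_r.
    exists a. split; [lra |].
    assert (0 <= - (a ^ 2 * Y1 a) - 35 / 3 * a ^ 3).
    { apply nonneg_from_zero with (f := fun s => - (s ^ 2 * Y1 s) - 35 / 3 * s ^ 3)
        (f' := fun x => - (x ^ 2 * (Y x * (eps - Y x ^ 2))) - 35 * x ^ 2) (b := a); [| | | lra].
      - intros x Hx. pose proof (rgs_eqn x ltac:(lra)). derive. field. lra.
      - intros x Hx. specialize (HC x ltac:(lra)). apply Rabs_def2 in HC.
        assert (35 <= Y x * (Y x ^ 2 - eps)).
        { assert (25 <= Y x ^ 2) by nra. assert (5 <= Y x) by lra.
          apply Rle_trans with (5 * 7); [lra |]. apply Rmult_le_compat; lra. }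
        replace (- (x ^ 2 * (Y x * (eps - Y x ^ 2))) - 35 * x ^ 2)
          with (x ^ 2 * (Y x * (Y x ^ 2 - eps) - 35)) by ring.
        apply Rmult_le_pos; [apply pow2_ge_0 | lra].
      - apply near0_ext with (fun s => -1 * (s ^ 2 * Y1 s) + - (35 / 3) * s ^ 3);
          [intros; ring |].
        apply near0_plus; apply near0_scal.
        + apply (near0_weaken 2); [lia |].
          apply (near0_mult 2 0); [apply near0_pow |
            apply (profile_origin1 _ _ _ _ (rgs_profile _ _ _ HY 1))].
        + apply (near0_weaken 3); [lia | apply near0_pow]. }
    assert (0 < a ^ 3) by (apply pow_lt; lra). lra. }
  destruct Hstart as (a & Ha & HYa).
  destruct (first_crossing (fun s => s ^ 2 * Y1 s) a s) as (m & Hm & Hm0 & Hbelow).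
  - lra.
  - intros x Hx. eapply is_derive_continuity. apply Hd. lra.
  - assumption.
  - apply Rmult_le_pos; [apply pow2_ge_0 | lra].
  - assert (HYm : Y1 m = 0).
    { apply Rmult_integral in Hm0. destruct Hm0 as [H | H]; [| assumption].
      exfalso. apply pow_nonzero in H; [assumption | lra]. }
    pose proof (rgs_mechanical_energy_pos m ltac:(lra)) as HE. rewrite HYm in HE.
    pose proof (rgs_pos m ltac:(lra)) as Hpos.
    assert (Hgap : eps - Y m ^ 2 < 0).
    { assert (0 < Y m ^ 2) by (apply pow_lt; lra). pose proof (rgs_eps _ _ _ HY). nra. }
    assert (Hcont : continuity_pt (fun x => eps - Y x ^ 2) m).
    { pose proof (rgs_derive m ltac:(lra)). eapply is_derive_continuity. derive. reflexivity. }
    destruct (Hcont (- (eps - Y m ^ 2)) ltac:(lra)) as (d & Hd0 & Hdc).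
    set (t := Rmax (m - d / 2) a).
    assert (Ht : m - d / 2 <= t < m /\ a <= t).
    { unfold t. split; [split |]; [apply Rmax_l | apply Rmax_lub_lt; lra | apply Rmax_r]. }
    assert (- (t ^ 2 * Y1 t) <= - (m ^ 2 * Y1 m)).
    { apply nondecreasing_of_derive with (f := fun s => - (s ^ 2 * Y1 s))
        (f' := fun x => - (x ^ 2 * (Y x * (eps - Y x ^ 2)))); [lra | |].
      - intros x Hx. apply (derive_opp (fun s => s ^ 2 * Y1 s)). apply Hd. lra.
      - intros x Hx. pose proof (rgs_pos x ltac:(lra)).
        assert (eps - Y x ^ 2 <= 0).
        { destruct (Req_dec x m) as [-> | Hne]; [lra |].
          specialize (Hdc x). unfold dist in Hdc; simpl in Hdc; unfold Rdist, D_x, no_cond in Hdc.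
          assert (Habs : Rabs (eps - Y x * (Y x * 1) - (eps - Y m * (Y m * 1)))
                  < - (eps - Y m * (Y m * 1))).
          { apply Hdc. split; [split; [trivial | lra] |]. rewrite Rabs_left; lra. }
          apply Rabs_def2 in Habs. simpl. lra. }
        assert (0 <= x ^ 2) by apply pow2_ge_0.
        assert (Y x * (eps - Y x ^ 2) <= 0) by nra. nra. }
    specialize (Hbelow t ltac:(lra)). rewrite HYm in H. lra.
Qed.

(** Where [p] vanishes [Y^2 > 2 eps], and [Y] decreases: a small value of [Y] forces [p < 0]. *)
Lemma rgs_p_neg s : 0 < s -> Y s ^ 2 <= 2 * eps -> p s < 0.
Proof.
  intros Hs HYs. destruct (Rlt_dec (p s) 0) as [|Hn]; [assumption | exfalso].
  assert (Hnz : forall m, s <= m -> p m <> 0).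
  { intros m Hm H0. pose proof (rgs_log_slope_energy m ltac:(lra)) as H.
    rewrite H0 in H. unfold Rdiv at 2 in H. rewrite Rmult_0_l in H.
    assert (Y m <= Y s).
    { assert (- Y s <= - Y m); [| lra].
      apply nondecreasing_of_derive with (f := fun u => - Y u) (f' := fun u => - Y1 u);
        [assumption | |].
      - intros x Hx. apply (derive_opp Y), rgs_derive. lra.
      - intros x Hx. pose proof (rgs_slope_neg x ltac:(lra)). lra. }
    pose proof (rgs_pos m ltac:(lra)).
    assert (Y m ^ 2 <= Y s ^ 2) by (apply pow_incr; lra). lra. }
  destruct rgs_far as (s0 & Hs0 & Hfar).
  set (t := Rmax s0 (s + 1)). assert (s0 <= t) by apply Rmax_l. assert (s + 1 <= t) by apply Rmax_r.
  destruct (Hfar t ltac:(lra)) as [Hpt _].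
  destruct (first_crossing (fun u => - p u) s t) as (m & Hm & Hm0 & _).
  - lra.
  - intros x Hx. eapply is_derive_continuity. apply (derive_opp p), rgs_p_derive. lra.
  - specialize (Hnz s ltac:(lra)). lra.
  - lra.
  - apply (Hnz m); lra.
Qed.
End GroundState.

(** * Explicit reference profiles *)

(** The inverse square of a profile is a much tamer function of [x = s^2] than the profile
    itself (poles become zeros), so that [6 / sqrt (p x / d)] with [p] of degree six solves the
    cubic equation up to a few parts in a thousand in the mass. *)
Definition ref_profile (d : Z) (p : list Z) (s : R) : R :=
  6 / sqrt (peval p (s ^ 2) / IZR d).

Definition ref_slope (d : Z) (p : list Z) (s : R) : R :=
  - (s * (peval (pderiv p) (s ^ 2) / peval p (s ^ 2))) * ref_profile d p s.

(** The mass [y''/y + 2 y'/(s y) + y^2] for which the profile [y] of [p] is an exact solution,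
    multiplied by [p^2]; it is a polynomial in [x = s^2]. *)
Definition mass_numerator (d : Z) (p : list Z) : list Z :=
  padd (pscale 3 (0%Z :: pmul (pderiv p) (pderiv p)))
    (padd (pscale (-3) (pmul p (pderiv p)))
      (padd (pscale (-2) (0%Z :: pmul p (pderiv (pderiv p)))) (pscale (36 * d) p))).

Definition ref_mass (d : Z) (p : list Z) (s : R) : R :=
  peval (mass_numerator d p) (s ^ 2) / peval p (s ^ 2) ^ 2.

Lemma derive_peval_square p s :
  is_derive (fun s => peval p (s ^ 2)) s (2 * s * peval (pderiv p) (s ^ 2)).
Proof.
  eapply is_derive_to.
  - apply (derive_comp (peval p) (fun s => s ^ 2)); [apply is_derive_peval | derive; reflexivity].
  - simpl. ring.
Qed.

Lemma near0_peval_square p : near0 0 (fun s => peval p (s ^ 2)).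
Proof.
  induction p as [|c p IH]; simpl.
  - apply near0_const.
  - apply near0_plus; [apply near0_const |].
    apply (near0_mult 0 0); [| exact IH].
    apply (near0_weaken 2); [lia | apply near0_pow].
Qed.

Lemma ref_profile_sq d p s : (0 < d)%Z -> 0 < peval p (s ^ 2) ->
  ref_profile d p s ^ 2 = 36 * IZR d / peval p (s ^ 2).
Proof.
  intros Hd Hp. apply IZR_lt in Hd. unfold ref_profile.
  assert (Hq : 0 < peval p (s ^ 2) / IZR d) by now apply Rdiv_lt_0_compat.
  pose proof (sqrt_lt_R0 _ Hq).
  replace ((6 / sqrt (peval p (s ^ 2) / IZR d)) ^ 2)
    with (36 / sqrt (peval p (s ^ 2) / IZR d) ^ 2) by (field; lra).
  rewrite pow2_sqrt by lra. field. split; lra.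
Qed.

Lemma ref_profile_pos d p s : (0 < d)%Z -> 0 < peval p (s ^ 2) -> 0 < ref_profile d p s.
Proof.
  intros Hd Hp. apply IZR_lt in Hd. apply Rdiv_lt_0_compat; [lra |].
  now apply sqrt_lt_R0, Rdiv_lt_0_compat.
Qed.

Lemma ref_profile_derive d p s : (0 < d)%Z -> 0 < peval p (s ^ 2) ->
  is_derive (ref_profile d p) s (ref_slope d p s).
Proof.
  intros Hd Hp. pose proof (IZR_lt _ _ Hd) as Hd'. unfold ref_slope, ref_profile.
  assert (Hq : 0 < peval p (s ^ 2) / IZR d) by now apply Rdiv_lt_0_compat.
  pose proof (sqrt_lt_R0 _ Hq) as Hs.
  assert (Hds : is_derive (fun s => sqrt (peval p (s ^ 2) / IZR d)) s
    (2 * s * peval (pderiv p) (s ^ 2) / IZR d * / (2 * sqrt (peval p (s ^ 2) / IZR d)))).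
  { apply (derive_comp sqrt (fun s => peval p (s ^ 2) / IZR d)).
    - eapply is_derive_to.
      + apply (is_derive_Reals sqrt (peval p (s ^ 2) / IZR d)). now apply derivable_pt_lim_sqrt.
      + reflexivity.
    - pose proof (derive_peval_square p s). derive; [lra |]. field. lra. }
  derive; [lra |].
  assert (Hsq : sqrt (peval p (s ^ 2) / IZR d) ^ 2 = peval p (s ^ 2) / IZR d)
    by (apply pow2_sqrt; lra).
  set (r := sqrt (peval p (s ^ 2) / IZR d)) in *.
  assert (Hpe : peval p (s ^ 2) = IZR d * r ^ 2) by (rewrite Hsq; field; lra).
  rewrite Hpe. field. split; lra.
Qed.

Lemma ref_profile_equation d p s : (0 < d)%Z -> 0 < s -> 0 < peval p (s ^ 2) ->
  is_derive (ref_slope d p) s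
    (ref_mass d p s * ref_profile d p s - ref_profile d p s ^ 3 - 2 / s * ref_slope d p s).
Proof.
  intros Hd Hs Hp.
  pose proof (ref_profile_derive d p s Hd Hp).
  pose proof (derive_peval_square p s). pose proof (derive_peval_square (pderiv p) s).
  unfold ref_slope at 1. derive; [lra |].
  replace (ref_profile d p s ^ 3) with (ref_profile d p s ^ 2 * ref_profile d p s) by ring.
  rewrite ref_profile_sq by assumption. unfold ref_mass, ref_slope, mass_numerator.
  rewrite !peval_add, !peval_scale, mult_IZR. cbn [peval]. rewrite !peval_mul.
  field. split; lra.
Qed.

Lemma ref_profile_is_profile d t :
  (0 < d)%Z -> (forall x, 0 <= x <= 1 -> 0 < peval (d :: t) x) ->
  profile (ref_mass d (d :: t)) 1 (ref_profile d (d :: t)) (ref_slope d (d :: t)).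
Proof.
  intros Hd Hp. set (p := d :: t) in *.
  assert (Hps : forall s, 0 < s <= 1 -> 0 < peval p (s ^ 2)).
  { intros s Hs. apply Hp. split; [apply pow2_ge_0 |].
    replace 1 with (1 ^ 2) by ring. apply pow_incr; lra. }
  pose proof (IZR_lt _ _ Hd) as Hd'.
  assert (HN : near0 1 (fun s => peval p (s ^ 2) - IZR d)).
  { apply near0_ext with (fun s => s ^ 2 * peval t (s ^ 2)); [intros; simpl; ring |].
    apply (near0_weaken 2); [lia |].
    apply (near0_mult 2 0); [apply near0_pow | apply near0_peval_square]. }
  assert (HI : near0 0 (fun s => / peval p (s ^ 2))) by (apply near0_inv with (IZR d); [lra | exact HN]).
  assert (H0 : near0 1 (fun s => ref_profile d p s - 6)).
  { assert (H6 : near0 0 (fun s => / (ref_profile d p s + 6))).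
    { exists (/ 6), 1. split; [lra |]. intros s Hs. simpl. rewrite Rmult_1_r.
      pose proof (ref_profile_pos d p s Hd (Hps s ltac:(lra))).
      rewrite Rabs_right; [apply Rinv_le_contravar; lra |].
      left. apply Rinv_0_lt_compat. lra. }
    assert (Hq : near0 1 (fun s => (peval p (s ^ 2) - IZR d)
       * (-36 * (/ peval p (s ^ 2) * / (ref_profile d p s + 6))))).
    { apply (near0_mult 1 0); [assumption |]. apply near0_scal. now apply (near0_mult 0 0). }
    destruct Hq as (C' & d' & Hd'' & HC').
    exists C', (Rmin d' 1). split; [apply Rmin_pos; lra |]. intros s Hs.
    pose proof (Rmin_l d' 1). pose proof (Rmin_r d' 1).
    specialize (HC' s ltac:(lra)).
    pose proof (ref_profile_pos d p s Hd (Hps s ltac:(lra))).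
    pose proof (Hps s ltac:(lra)).
    replace (ref_profile d p s - 6) with ((peval p (s ^ 2) - IZR d)
       * (-36 * (/ peval p (s ^ 2) * / (ref_profile d p s + 6)))); [exact HC' |].
    apply Rmult_eq_reg_r with (ref_profile d p s + 6); [| lra].
    replace ((ref_profile d p s - 6) * (ref_profile d p s + 6))
      with (ref_profile d p s ^ 2 - 36) by ring.
    rewrite ref_profile_sq by assumption. field. split; lra. }
  split.
  - intros s Hs. apply ref_profile_pos; auto.
  - intros s Hs. apply ref_profile_derive; auto.
  - intros s Hs. apply ref_profile_equation; auto. lra.
  - exact H0.
  - apply near0_ext with (fun s => -1 * (s ^ 1 * (peval (pderiv p) (s ^ 2) * / peval p (s ^ 2))
       * ref_profile d p s)); [intros; unfold ref_slope, Rdiv; ring |].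
    apply near0_scal, (near0_mult 0 0).
    + apply (near0_weaken 1); [lia |]. apply (near0_mult 1 0); [apply near0_pow |].
      apply (near0_mult 0 0); [apply near0_peval_square | assumption].
    + apply near0_ext with (fun s => (ref_profile d p s - 6) + 6); [intros; ring |].
      apply near0_plus; [apply (near0_weaken 1); [lia | assumption] | apply near0_const].
Qed.

Lemma ref_log_slope d p s : (0 < d)%Z -> 0 < peval p (s ^ 2) ->
  ref_slope d p s / ref_profile d p s
  = - (s * (peval (pderiv p) (s ^ 2) / peval p (s ^ 2))).
Proof.
  intros Hd Hp. pose proof (ref_profile_pos d p s Hd Hp). unfold ref_slope. field. lra.
Qed.

(** [p (h'' + 2 h'/s + 2 y' h'/y) - p] for [h = k (s^2) / dk] and [y] the profile of [p],
    multiplied by [dk]. *)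
Definition gauge_excess (p : list Z) (dk : Z) (k : list Z) : list Z :=
  padd (pmul p (padd (pscale 6 (pderiv k)) (pscale 4 (0%Z :: pderiv (pderiv k)))))
    (padd (pscale (-4) (0%Z :: pmul (pderiv p) (pderiv k))) (pscale (- dk) p)).

Lemma ref_gauge d p dk k :
  (0 < d)%Z -> (0 < dk)%Z ->
  (forall x, 0 <= x <= 1 -> 0 < peval p x) ->
  (forall x, 0 <= x <= 1 -> 0 < peval (gauge_excess p dk (0%Z :: k)) x) ->
  (forall x, 0 <= x -> 0 <= peval (0%Z :: k) x) ->
  gauge 1 (ref_profile d p) (ref_slope d p)
    (fun s => peval (0%Z :: k) (s ^ 2) / IZR dk)
    (fun s => 2 * s * peval (pderiv (0%Z :: k)) (s ^ 2) / IZR dk)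
    (fun s => (2 * peval (pderiv (0%Z :: k)) (s ^ 2)
               + 4 * s ^ 2 * peval (pderiv (pderiv (0%Z :: k))) (s ^ 2)) / IZR dk).
Proof.
  intros Hd Hdk Hp Hk Hk0. set (K := 0%Z :: k) in *.
  pose proof (IZR_lt _ _ Hdk) as Hdk'.
  split.
  - intros s Hs. pose proof (derive_peval_square K s). derive; [lra |]. field. lra.
  - intros s Hs. pose proof (derive_peval_square (pderiv K) s). derive; [lra |]. field. lra.
  - intros s Hs.
    assert (Hx : 0 <= s ^ 2 <= 1).
    { split; [apply pow2_ge_0 |]. replace 1 with (1 ^ 2) by ring. apply pow_incr; lra. }
    specialize (Hp _ Hx). specialize (Hk _ Hx).
    rewrite ref_log_slope by assumption.
    unfold gauge_excess in Hk. rewrite !peval_add, peval_mul, !peval_add, !peval_scale in Hk.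
    cbn [peval] in Hk. rewrite peval_mul, opp_IZR in Hk.
    apply Rmult_le_reg_l with (peval p (s ^ 2) * IZR dk); [now apply Rmult_lt_0_compat |].
    field_simplify; [| lra]. field_simplify in Hk. lra.
  - intros s Hs. apply Rmult_le_pos; [apply Hk0, pow2_ge_0 |].
    left. now apply Rinv_0_lt_compat.
  - apply near0_ext with (fun s => s ^ 2 * (/ IZR dk * peval k (s ^ 2)));
      [intros; unfold K; simpl; field; lra |].
    apply (near0_weaken 2); [lia |].
    apply (near0_mult 2 0); [apply near0_pow | apply near0_scal, near0_peval_square].
  - apply near0_ext with (fun s => s ^ 1 * (2 / IZR dk * peval (pderiv K) (s ^ 2)));
      [intros; simpl; field; lra |].
    apply (near0_weaken 1); [lia |].
    apply (near0_mult 1 0); [apply near0_pow | apply near0_scal, near0_peval_square].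
Qed.

Lemma positive_on_unit k n p x :
  positive_on k 0 n p = true -> (0 < n)%nat -> (0 < k)%Z -> INR n = IZR k ->
  0 <= x <= 1 -> 0 < peval p x.
Proof.
  intros H Hn Hk Hnk Hx. apply positive_on_spec with k 0%nat n; try assumption.
  pose proof (IZR_lt _ _ Hk). simpl. nra.
Qed.

(** Obtained by collocation from the solution of mass 1.93, slightly above the true mass 1.914,
    and rounded. *)
Definition p_high : list Z := (1000 :: 11357 :: 36495 :: 24273 :: 5350 :: 888 :: -106 :: nil)%Z.
(** Rounded collocation solution of mass 2.01: larger than every mass left by the
    comparison with [p_high], but small enough for the supersolutions to exist. *)
Definition p_top : list Z := (100 :: 1133 :: 3624 :: 2331 :: 385 :: -7 :: -47 :: nil)%Z.
(** A rounded solution of [(s^2 y^2 h')' = 1.02 s^2 y^2], with the denominator 100; it serves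
    both reference profiles. *)
Definition k_gauge : list Z := (0 :: 17 :: 36 :: 3 :: 2 :: nil)%Z.

Lemma p_high_pos x : 0 <= x <= 1 -> 0 < peval p_high x.
Proof. intros Hx. cbn [peval p_high]. nra. Qed.

Lemma p_top_pos x : 0 <= x <= 1 -> 0 < peval p_top x.
Proof.
  apply (positive_on_unit 8 8); [vm_compute; reflexivity | lia | lia | simpl; lra].
Qed.

Lemma mass_bounds d p lo hi q k n x :
  (0 < q)%Z -> (0 < k)%Z -> (0 < n)%nat -> INR n = IZR k -> 0 <= x <= 1 ->
  0 < peval p x ->
  positive_on k 0 n (padd (pscale q (mass_numerator d p)) (pscale (- lo) (pmul p p))) = true ->
  positive_on k 0 n (padd (pscale hi (pmul p p)) (pscale (- q) (mass_numerator d p))) = true ->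
  IZR lo / IZR q <= peval (mass_numerator d p) x / peval p x ^ 2 <= IZR hi / IZR q.
Proof.
  intros Hq Hk Hn Hnk Hx Hp Hlo Hhi.
  apply positive_on_unit with (x := x) in Hlo; try assumption.
  apply positive_on_unit with (x := x) in Hhi; try assumption.
  rewrite peval_add, !peval_scale, peval_mul, opp_IZR in Hlo.
  rewrite peval_add, !peval_scale, peval_mul, opp_IZR in Hhi.
  apply IZR_lt in Hq. assert (Hp2 : 0 < peval p x ^ 2) by now apply pow_lt.
  set (m := peval (mass_numerator d p) x) in *. set (v := peval p x) in *.
  assert (Hm : m = m / v ^ 2 * v ^ 2) by (field; lra).
  set (e := m / v ^ 2) in *. rewrite Hm in Hlo, Hhi.
  assert (IZR lo / IZR q * IZR q = IZR lo) by (field; lra).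
  assert (IZR hi / IZR q * IZR q = IZR hi) by (field; lra).
  split; apply Rmult_le_reg_r with (IZR q * v ^ 2); try (apply Rmult_lt_0_compat; assumption);
    rewrite <- !Rmult_assoc; nra.
Qed.

Lemma mass_high s : 0 < s <= 1 -> 1.928 <= ref_mass 1000 p_high s <= 1.932.
Proof.
  intros Hs.
  assert (Hx : 0 <= s ^ 2 <= 1).
  { split; [apply pow2_ge_0 |]. replace 1 with (1 ^ 2) by ring. apply pow_incr; lra. }
  pose proof (mass_bounds 1000 p_high 1928 1932 1000 32 32 (s ^ 2)
    ltac:(lia) ltac:(lia) ltac:(lia) ltac:(simpl; lra) Hx (p_high_pos _ Hx)
    ltac:(vm_compute; reflexivity) ltac:(vm_compute; reflexivity)).
  unfold ref_mass. lra.
Qed.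

Lemma mass_top s : 0 < s <= 1 -> 2.008 <= ref_mass 100 p_top s <= 2.012.
Proof.
  intros Hs.
  assert (Hx : 0 <= s ^ 2 <= 1).
  { split; [apply pow2_ge_0 |]. replace 1 with (1 ^ 2) by ring. apply pow_incr; lra. }
  pose proof (mass_bounds 100 p_top 2008 2012 1000 32 32 (s ^ 2)
    ltac:(lia) ltac:(lia) ltac:(lia) ltac:(simpl; lra) Hx (p_top_pos _ Hx)
    ltac:(vm_compute; reflexivity) ltac:(vm_compute; reflexivity)).
  unfold ref_mass. lra.
Qed.

Definition h_gauge (s : R) : R := peval k_gauge (s ^ 2) / 100.

Lemma k_gauge_nonneg x : 0 <= x -> 0 <= peval k_gauge x.
Proof.
  intros Hx. cbn [peval k_gauge].
  repeat (apply Rplus_le_le_0_compat; [lra |]; try apply Rmult_le_pos; try lra).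
Qed.

Lemma gauge_high : exists h1 h2,
  gauge 1 (ref_profile 1000 p_high) (ref_slope 1000 p_high) h_gauge h1 h2.
Proof.
  eexists. eexists. apply (ref_gauge 1000 p_high 100 (tl k_gauge)); try lia.
  - exact p_high_pos.
  - intros x. apply (positive_on_unit 16 16); [vm_compute; reflexivity | lia | lia | simpl; lra].
  - exact k_gauge_nonneg.
Qed.

Lemma gauge_top : exists h1 h2,
  gauge 1 (ref_profile 100 p_top) (ref_slope 100 p_top) h_gauge h1 h2.
Proof.
  eexists. eexists. apply (ref_gauge 100 p_top 100 (tl k_gauge)); try lia.
  - exact p_top_pos.
  - intros x. apply (positive_on_unit 16 16); [vm_compute; reflexivity | lia | lia | simpl; lra].
  - exact k_gauge_nonneg.
Qed.

Lemma profile_high :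
  profile (ref_mass 1000 p_high) 1 (ref_profile 1000 p_high) (ref_slope 1000 p_high).
Proof. apply ref_profile_is_profile; [lia | exact p_high_pos]. Qed.

Lemma profile_top :
  profile (ref_mass 100 p_top) 1 (ref_profile 100 p_top) (ref_slope 100 p_top).
Proof. apply ref_profile_is_profile; [lia | exact p_top_pos]. Qed.

(** * The mass of the ground state is below 1.97 *)

Lemma square_unit s : 0 < s <= 1 -> 0 <= s ^ 2 <= 1.
Proof.
  intros Hs. split; [apply pow2_ge_0 |]. replace 1 with (1 ^ 2) by ring. apply pow_incr; lra.
Qed.

(** Positive where, for masses between [a/1000] and [b/1000], the hypotheses of
    [square_gap_above] hold for [p_high]; it is
    [(a - 1932) (1 - (b/1000 - 1.928) h) Z - 72 (a - 1928) h] up to a positive factor, with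
    [h = k_gauge/100] and [Z = p_high/1000]. *)
Definition gap_margin (a b : Z) : list Z :=
  padd (pscale (a - 1932)%Z (pmul (padd (100000%Z :: nil) (pscale (1928 - b)%Z k_gauge)) p_high))
       (pscale (-72000000 * (a - 1928))%Z k_gauge).

(** At [S] the logarithmic derivative of [s Y] would be negative and above that of the reference,
    hence smaller in absolute value, while [Y] is not much larger than the reference; the
    last hypothesis makes this incompatible with [rgs_log_slope_energy]. *)
Lemma mass_excluded eps Y Y1 (a b : Z) S k n :
  rescaled_ground_state eps Y Y1 ->
  0 < S <= 1 -> (1932 < a)%Z ->
  positive_on k 0 n (gap_margin a b) = true ->
  (0 < k)%Z -> (0 < n)%nat -> IZR k * S ^ 2 <= INR n ->
  (peval p_high (S ^ 2) - S ^ 2 * peval (pderiv p_high) (S ^ 2)) ^ 2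
    + 18000 * peval p_high (S ^ 2) * S ^ 2
    <= (IZR a / 1000 + 1.932) / 2 * (peval p_high (S ^ 2) ^ 2 * S ^ 2) ->
  ~ IZR a / 1000 <= eps <= IZR b / 1000.
Proof.
  intros HY HS Ha Hpos Hk Hn HkS Hcrit Heps. apply IZR_lt in Ha.
  destruct gauge_high as (h1 & h2 & Hh).
  assert (HP := rgs_profile _ _ _ HY S).
  assert (Hy := profile_shrink _ 1 S _ _ ltac:(lra) profile_high).
  apply (gauge_shrink 1 S) in Hh; [| lra].
  set (y := ref_profile 1000 p_high) in *. set (y1 := ref_slope 1000 p_high) in *.
  set (lo := eps - 1.932). set (hi := eps - 1.928).
  assert (Hlo : 0 < lo) by (unfold lo; lra).
  assert (Hmargin : forall s, 0 < s <= S ->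
    hi * h_gauge s < 1 /\ 2 * y s ^ 2 * (hi * h_gauge s) < lo * (1 - hi * h_gauge s)).
  { intros s Hs.
    pose proof (square_unit s ltac:(lra)) as Hx.
    pose proof (p_high_pos _ Hx) as Hp.
    assert (Hkx : 0 < peval (gap_margin a b) (s ^ 2)).
    { apply positive_on_spec with k 0%nat n; try assumption. simpl INR.
      apply IZR_lt in Hk.
      assert (s ^ 2 <= S ^ 2) by (apply pow_incr; lra).
      assert (0 <= IZR k * s ^ 2) by (apply Rmult_le_pos; lra).
      assert (IZR k * s ^ 2 <= IZR k * S ^ 2) by (apply Rmult_le_compat_l; lra). lra. }
    unfold gap_margin in Hkx.
    rewrite peval_add, !peval_scale, peval_mul, peval_add, peval_scale, mult_IZR, !minus_IZR in Hkx.
    pose proof (k_gauge_nonneg (s ^ 2) ltac:(lra)) as HK.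
    unfold y. rewrite ref_profile_sq by (lia || assumption). unfold h_gauge.
    cbn [peval] in Hkx. rewrite Rmult_0_r, Rplus_0_r in Hkx.
    set (N := peval p_high (s ^ 2)) in *. set (K := peval k_gauge (s ^ 2)) in *.
    set (m := 1 - (IZR b / 1000 - 1.928) * (K / 100)).
    assert (H1 : 72 * ((IZR a / 1000 - 1.928) * (K / 100))
                 < (IZR a / 1000 - 1.932) * m * (N / 1000)) by (unfold m; lra).
    assert (Hh0 : 0 <= K / 100) by lra.
    assert (Hm : 0 < m).
    { destruct (Rlt_dec 0 m) as [|Hn0]; [assumption | exfalso].
      assert (0 <= (IZR a / 1000 - 1.928) * (K / 100)) by (apply Rmult_le_pos; lra).
      assert ((IZR a / 1000 - 1.932) * m * (N / 1000) <= 0); [| lra].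
      assert ((IZR a / 1000 - 1.932) * m <= 0) by nra. nra. }
    assert (Hhi : hi * (K / 100) <= (IZR b / 1000 - 1.928) * (K / 100))
      by (apply Rmult_le_compat_r; unfold hi; lra).
    set (x := hi * (K / 100)) in *.
    assert (Hmx : m <= 1 - x) by (unfold m; lra).
    split; [lra |].
    replace (2 * (36 * 1000 / N) * x) with (72 * x / (N / 1000)) by (field; lra).
    apply Rmult_lt_reg_r with (N / 1000); [lra |].
    replace (72 * x / (N / 1000) * (N / 1000)) with (72 * x) by (field; lra).
    apply Rmult_lt_reg_l with (IZR a / 1000 - 1.932); [lra |].
    (* [hi / lo] decreases with [eps], so its value at the left end is the worst *)
    assert (Hr : (IZR a / 1000 - 1.932) * hi <= lo * (IZR a / 1000 - 1.928))
      by (unfold lo, hi; nra).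
    assert (H2 : (IZR a / 1000 - 1.932) * (72 * x)
                 <= lo * (72 * ((IZR a / 1000 - 1.928) * (K / 100)))).
    { replace ((IZR a / 1000 - 1.932) * (72 * x))
        with (((IZR a / 1000 - 1.932) * hi) * (72 * (K / 100))) by (unfold x; ring).
      replace (lo * (72 * ((IZR a / 1000 - 1.928) * (K / 100))))
        with ((lo * (IZR a / 1000 - 1.928)) * (72 * (K / 100))) by ring.
      apply Rmult_le_compat_r; lra. }
    eapply Rle_lt_trans; [exact H2 |].
    apply Rlt_le_trans with (lo * ((IZR a / 1000 - 1.932) * m * (N / 1000)));
      [now apply Rmult_lt_compat_l |].
    replace ((IZR a / 1000 - 1.932) * (lo * (1 - x) * (N / 1000)))
      with (lo * ((IZR a / 1000 - 1.932) * (1 - x) * (N / 1000))) by ring.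
    apply Rmult_le_compat_l; [lra |]. apply Rmult_le_compat_r; [lra |].
    apply Rmult_le_compat_l; lra. }
  assert (Hmass : forall s, 0 < s <= S -> lo <= eps - ref_mass 1000 p_high s <= hi).
  { intros s Hs. pose proof (mass_high s ltac:(lra)). unfold lo, hi. lra. }
  assert (Hgap := square_gap_above _ eps lo hi S Y Y1 y y1 h_gauge h1 h2 HP Hy Hh Hlo Hmass
    (fun s Hs => proj1 (Hmargin s Hs)) (fun s Hs => proj2 (Hmargin s Hs))).
  assert (Hord := sturm_comparison _ (fun _ => eps) S y y1 Y Y1 Hy HP
    (fun s Hs => Rlt_le _ _ (Rlt_le_trans _ _ _ (Hgap s Hs) (proj1 (Hmass s Hs))))).
  specialize (Hgap S ltac:(lra)). destruct (Hord S ltac:(lra)) as [HW _].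
  pose proof (p_high_pos _ (square_unit S HS)) as Hp.
  pose proof (ref_log_slope 1000 p_high S ltac:(lia) Hp) as Hls. fold y y1 in Hls.
  pose proof (ref_profile_pos 1000 p_high S ltac:(lia) Hp) as Hypos. fold y in Hypos.
  unfold y in Hgap. rewrite ref_profile_sq in Hgap by (lia || assumption).
  set (N := peval p_high (S ^ 2)) in *. set (N1 := peval (pderiv p_high) (S ^ 2)) in *.
  pose proof (rgs_pos _ _ _ HY S ltac:(lra)) as HYp.
  set (rho0 := 1 / S - S * (N1 / N)).
  assert (Hrho0 : rho0 ^ 2 + 18000 / N <= (IZR a / 1000 + 1.932) / 2).
  { apply Rmult_le_reg_r with (N ^ 2 * S ^ 2).
    { apply Rmult_lt_0_compat; apply pow_lt; lra. }
    replace ((rho0 ^ 2 + 18000 / N) * (N ^ 2 * S ^ 2))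
      with ((N - S ^ 2 * N1) ^ 2 + 18000 * N * S ^ 2) by (unfold rho0; field; lra).
    exact Hcrit. }
  assert (HY2 : Y S ^ 2 < 36000 / N + lo) by lra.
  assert (H18 : 36000 / N = 2 * (18000 / N)) by (field; lra).
  assert (Hrho2 : 0 <= rho0 ^ 2) by apply pow2_ge_0.
  assert (Hpneg := rgs_p_neg _ _ _ HY S ltac:(lra) ltac:(unfold lo in HY2; lra)).
  pose proof (rgs_log_slope_energy _ _ _ HY S ltac:(lra)) as HE.
  set (rho := (Y S + S * Y1 S) / (S * Y S)) in *.
  assert (Hr1 : rho < 0).
  { assert (0 < (- (Y S + S * Y1 S)) / (S * Y S)).
    { apply Rdiv_lt_0_compat; [lra | apply Rmult_lt_0_compat; lra]. }
    unfold rho. replace (- (Y S + S * Y1 S) / (S * Y S)) with (- ((Y S + S * Y1 S) / (S * Y S)))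
      in H by (field; lra). lra. }
  assert (Hr2 : rho0 <= rho).
  { assert (0 <= (y S * Y1 S - y1 S * Y S) / (y S * Y S)).
    { apply Rmult_le_pos; [assumption |]. left.
      apply Rinv_0_lt_compat, Rmult_lt_0_compat; assumption. }
    replace (rho0) with (1 / S + y1 S / y S) by (rewrite Hls; unfold rho0; ring).
    replace rho with (1 / S + Y1 S / Y S) by (unfold rho; field; lra).
    replace ((y S * Y1 S - y1 S * Y S) / (y S * Y S)) with (Y1 S / Y S - y1 S / y S) in H
      by (field; lra). lra. }
  assert (rho ^ 2 <= rho0 ^ 2) by nra.
  unfold lo in HY2. lra.
Qed.

Ltac exclude_masses HY a b S k n :=
  let H := fresh in let Hcrit := fresh in
  pose proof (mass_excluded _ _ _ a b S k n HY ltac:(lra) ltac:(lia)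
    ltac:(vm_compute; reflexivity) ltac:(lia) ltac:(lia) ltac:(simpl; lra)) as H;
  match type of H with ?crit -> _ => assert (Hcrit : crit) end;
  [ let q := eval vm_compute in (pderiv p_high) in change (pderiv p_high) with q;
    cbn [peval p_high]; lra
  | specialize (H Hcrit); clear Hcrit ].

(** A coarse bound for the mass is refined in eight steps: the smaller the interval of masses
    left, the longer the interval [(0, S]] on which the comparison is available. *)
Theorem mass_lt eps Y Y1 : rescaled_ground_state eps Y Y1 -> eps < 1.97.
Proof.
  intros HY. pose proof (rgs_eps_le _ _ _ HY) as H0.
  exclude_masses HY 15300%Z 18000%Z (6/20) 20%Z 2%nat.
  exclude_masses HY 10400%Z 15300%Z (7/20) 8%Z 1%nat.
  exclude_masses HY 7450%Z 10400%Z (8/20) 100%Z 16%nat.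
  exclude_masses HY 5600%Z 7450%Z (9/20) 24%Z 5%nat.
  exclude_masses HY 4450%Z 5600%Z (10/20) 8%Z 2%nat.
  exclude_masses HY 3150%Z 4450%Z (12/20) 60%Z 22%nat.
  exclude_masses HY 2200%Z 3150%Z (16/20) 16%Z 11%nat.
  exclude_masses HY 1970%Z 2200%Z 1 8%Z 8%nat.
  lra.
Qed.

(** * Bounds for the potential *)

(** In the second part, [s y] for the reference [y] has the logarithmic derivative
    [1 - 16597/7519 < - 1.207] at [1]. *)
Lemma potential_le eps Y Y1 : rescaled_ground_state eps Y Y1 ->
  (forall s, 0 < s <= 1 -> Y s ^ 2 <= 3600 / peval p_top (s ^ 2)) /\
  Y 1 + Y1 1 <= - 1.207 * Y 1.
Proof.
  intros HY. pose proof (mass_lt _ _ _ HY) as Heps. pose proof (rgs_eps _ _ _ HY) as Heps0.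
  destruct gauge_top as (h1 & h2 & Hh).
  assert (HP := rgs_profile _ _ _ HY 1). assert (Hy := profile_top).
  set (y := ref_profile 100 p_top) in *. set (y1 := ref_slope 100 p_top) in *.
  set (lo := 2.008 - eps). set (hi := 2.012 - eps).
  assert (Hsmall : forall s, 0 < s <= 1 -> 2 * y s ^ 2 * (hi * h_gauge s) < lo).
  { intros s Hs. pose proof (square_unit s Hs) as Hx. pose proof (p_top_pos _ Hx) as Hp.
    unfold y. rewrite ref_profile_sq by (lia || assumption).
    assert (HK : 0 < peval (padd (pscale 100 p_top) (pscale (-80 * 100) k_gauge)) (s ^ 2)).
    { apply (positive_on_unit 16 16); [vm_compute; reflexivity | lia | lia | simpl; lra | assumption]. }
    rewrite peval_add, !peval_scale in HK. rewrite mult_IZR in HK.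
    pose proof (k_gauge_nonneg (s ^ 2) ltac:(lra)). unfold h_gauge.
    set (N := peval p_top (s ^ 2)) in *. set (K := peval k_gauge (s ^ 2)) in *.
    apply Rmult_lt_reg_r with N; [assumption |].
    replace (2 * (36 * 100 / N) * (hi * (K / 100)) * N) with (hi * (72 * K)) by (field; lra).
    unfold hi, lo. nra. }
  assert (Hmass : forall s, 0 < s <= 1 -> lo <= ref_mass 100 p_top s - eps <= hi).
  { intros s Hs. pose proof (mass_top s Hs). unfold lo, hi. lra. }
  assert (Hgap := square_gap_below _ eps lo hi 1 Y Y1 y y1 h_gauge h1 h2 HP Hy Hh
    ltac:(unfold lo; lra) Hmass Hsmall).
  assert (Hord := sturm_comparison (fun _ => eps) _ 1 Y Y1 y y1 HP Hy
    (fun s Hs => Rlt_le _ _ (Rlt_le_trans _ _ _ (Hgap s Hs) (proj1 (Hmass s Hs))))).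
  split.
  - intros s Hs. destruct (Hord s Hs) as [_ HYy].
    pose proof (p_top_pos _ (square_unit s Hs)) as Hp.
    replace (3600 / peval p_top (s ^ 2)) with (y s ^ 2)
      by (unfold y; rewrite ref_profile_sq by (lia || assumption); field; lra).
    apply pow_incr. pose proof (rgs_pos _ _ _ HY s ltac:(lra)). lra.
  - destruct (Hord 1 ltac:(lra)) as [HW _].
    pose proof (p_top_pos _ (square_unit 1 ltac:(lra))) as Hp.
    assert (Hy1 : y1 1 <= - 2.207 * y 1).
    { unfold y1, ref_slope. fold y.
      pose proof (ref_profile_pos 100 p_top 1 ltac:(lia) Hp) as Hpos. fold y in Hpos.
      apply Rmult_le_compat_r; [lra |].
      let q := eval vm_compute in (pderiv p_top) in change (pderiv p_top) with q.
      cbn [peval p_top]. rewrite pow1, !Rmult_1_l.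
      match goal with |- - (?u / ?v) <= _ =>
        assert (2.207 * v <= u) by lra; assert (0 < v) by lra; assert (2.207 <= u / v) end.
      { apply Rmult_le_reg_r with (r := (100 + (1133 + (3624 + (2331 + (385 + (-7 + (-47 + 0)))))))); [lra |].
        unfold Rdiv. rewrite Rmult_assoc, Rinv_l; lra. }
      lra. }
    pose proof (ref_profile_pos 100 p_top 1 ltac:(lia) Hp) as Hpos. fold y in Hpos.
    pose proof (rgs_pos _ _ _ HY 1 ltac:(lra)) as HYpos.
    assert (Y1 1 * y 1 <= - 2.207 * Y 1 * y 1) by nra.
    assert (Y1 1 <= - 2.207 * Y 1) by (apply Rmult_le_reg_r with (y 1); assumption). lra.
Qed.

Definition tail_decay (s : R) : R := exp (- (2.414 * (s - 1))) / s ^ 2.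

(** The logarithmic derivative of [s Y] decreases, so its value at [1] controls the tail;
    [1.4364] is [108 / (p_top 1 / 100)] rounded up. *)
Lemma potential_tail eps Y Y1 : rescaled_ground_state eps Y Y1 ->
  forall s, 1 <= s -> 3 * Y s ^ 2 <= 1.4364 * tail_decay s.
Proof.
  intros HY s Hs. destruct (potential_le _ _ _ HY) as [HYy Hslope].
  pose proof (rgs_pos _ _ _ HY 1 ltac:(lra)) as HY1.
  assert (Hlog : forall t, 1 <= t -> Y t + t * Y1 t <= - 1.207 * (t * Y t)).
  { intros t Ht. pose proof (rgs_pos _ _ _ HY t ltac:(lra)) as HYt.
    pose proof (rgs_log_slope_decreasing _ _ _ HY 1 t ltac:(lra) Ht) as Hd.
    assert (Hone : (Y 1 + 1 * Y1 1) / (1 * Y 1) <= - 1.207).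
    { apply Rmult_le_reg_r with (1 * Y 1); [lra |]. unfold Rdiv.
      rewrite Rmult_assoc, Rinv_l by lra. lra. }
    assert (Hq : 0 < t * Y t) by (apply Rmult_lt_0_compat; lra).
    replace (Y t + t * Y1 t) with ((Y t + t * Y1 t) / (t * Y t) * (t * Y t)) by (field; lra).
    apply Rmult_le_compat_r; lra. }
  assert (Hq : s * Y s * exp (1.207 * (s - 1)) <= Y 1).
  { assert (- (1 * Y 1 * exp (1.207 * (1 - 1))) <= - (s * Y s * exp (1.207 * (s - 1)))).
    { apply nondecreasing_of_derive with (f := fun s => - (s * Y s * exp (1.207 * (s - 1))))
        (f' := fun s => - (Y s + s * Y1 s + 1.207 * (s * Y s)) * exp (1.207 * (s - 1)));
        [assumption | |].
      - intros x Hx. pose proof (rgs_derive _ _ _ HY x ltac:(lra)). derive. ring.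
      - intros x Hx. specialize (Hlog x ltac:(lra)).
        apply Rmult_le_pos; [lra |]. left. apply exp_pos. }
    replace (1.207 * (1 - 1)) with 0 in H by ring. rewrite exp_0 in H. lra. }
  assert (H1 : Y 1 ^ 2 <= 0.4788).
  { specialize (HYy 1 ltac:(lra)). rewrite pow1 in HYy.
    eapply Rle_trans; [exact HYy |]. cbn [peval p_top]. lra. }
  assert (Hpos : 0 <= s * Y s * exp (1.207 * (s - 1))).
  { pose proof (rgs_pos _ _ _ HY s ltac:(lra)). pose proof (exp_pos (1.207 * (s - 1))).
    apply Rmult_le_pos; [apply Rmult_le_pos |]; lra. }
  assert (Hsq : (s * Y s * exp (1.207 * (s - 1))) ^ 2 <= 0.4788).
  { eapply Rle_trans; [| exact H1]. apply pow_incr. lra. }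
  unfold tail_decay.
  assert (He : exp (1.207 * (s - 1)) ^ 2 * exp (- (2.414 * (s - 1))) = 1).
  { simpl. rewrite Rmult_1_r, <- !exp_plus.
    transitivity (exp 0); [f_equal; lra | apply exp_0]. }
  apply Rmult_le_reg_r with (exp (1.207 * (s - 1)) ^ 2 * s ^ 2).
  { apply Rmult_lt_0_compat; apply pow_lt; [apply exp_pos | lra]. }
  replace (1.4364 * (exp (- (2.414 * (s - 1))) / s ^ 2) * (exp (1.207 * (s - 1)) ^ 2 * s ^ 2))
    with (1.4364 * (exp (1.207 * (s - 1)) ^ 2 * exp (- (2.414 * (s - 1))))) by (field; lra).
  rewrite He. lra.
Qed.

(** * Riccati supersolutions and the linearized equation *)

(** Supersolutions [w] enter only through their logarithmic derivatives [Rf = w'/w], for which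
    the inequality says [w'' + V w < 0]. *)
Definition riccati_super (V : R -> R) (I : R -> Prop) (Rf : R -> R) : Prop :=
  forall s, I s -> exists d, is_derive Rf s d /\ d + Rf s ^ 2 + V s < 0.

Lemma derive_zero_fun (f : R -> R) a b s l :
  (forall t, a < t < b -> f t = 0) -> a < s < b -> is_derive f s l -> l = 0.
Proof.
  intros Hf Hs Hd.
  assert (H0 : is_derive (fun _ : R => 0) s l).
  { apply is_derive_ext_loc with f; [| assumption].
    assert (Hpos : 0 < Rmin (s - a) (b - s)) by (apply Rmin_pos; lra).
    exists (mkposreal _ Hpos). intros t Ht.
    unfold ball in Ht; simpl in Ht; unfold AbsRing_ball, abs, minus, plus, opp in Ht; simpl in Ht.
    apply Rabs_def2 in Ht. pose proof (Rmin_l (s - a) (b - s)). pose proof (Rmin_r (s - a) (b - s)).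
    apply Hf. lra. }
  rewrite <- (is_derive_unique _ _ _ H0). apply Derive_const.
Qed.

Record linear_solution (mu : R) (V v v1 : R -> R) : Prop := {
  lin_derive : forall s, 0 < s -> is_derive v s (v1 s);
  lin_eqn : forall s, 0 < s -> is_derive v1 s ((mu - V s) * v s) }.

(** Picone's identity: [F = v v' - R v^2] has derivative
    [(v' - R v)^2 + (mu - V - R' - R^2) v^2], a sum of nonnegative terms. *)
Definition picone (Rf v v1 : R -> R) (s : R) : R := v s * v1 s - Rf s * v s ^ 2.

Lemma picone_derive mu V v v1 I Rf s :
  0 <= mu -> linear_solution mu V v v1 -> riccati_super V I Rf -> I s -> 0 < s ->
  exists l, is_derive (picone Rf v v1) s l /\ 0 <= l /\ (v s <> 0 -> 0 < l).
Proof.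
  intros Hmu Hv HR HI Hs. destruct (HR s HI) as (d & Hd & Hneg).
  pose proof (lin_derive _ _ _ _ Hv s Hs). pose proof (lin_eqn _ _ _ _ Hv s Hs).
  exists ((v1 s - Rf s * v s) ^ 2 + (mu - (d + Rf s ^ 2 + V s)) * v s ^ 2).
  assert (0 <= (v1 s - Rf s * v s) ^ 2) by apply pow2_ge_0.
  split; [| split].
  - unfold picone. derive. ring.
  - apply Rplus_le_le_0_compat; [assumption |]. apply Rmult_le_pos; [lra | apply pow2_ge_0].
  - intros Hne. apply Rplus_le_lt_0_compat; [assumption |].
    apply Rmult_lt_0_compat; [lra |]. now apply pow2_gt_0.
Qed.

Lemma picone_nondecreasing mu V v v1 Rf a b :
  0 <= mu -> linear_solution mu V v v1 -> 0 < a -> a <= b ->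
  riccati_super V (fun s => a <= s <= b) Rf ->
  picone Rf v v1 a <= picone Rf v v1 b.
Proof.
  intros Hmu Hv Ha Hab HR.
  assert (H : forall s, a <= s <= b ->
    is_derive (picone Rf v v1) s (Derive (picone Rf v v1) s) /\ 0 <= Derive (picone Rf v v1) s).
  { intros s Hs.
    destruct (picone_derive mu V v v1 _ Rf s Hmu Hv HR Hs ltac:(lra)) as (l & Hl & Hl0 & _).
    rewrite (is_derive_unique _ _ _ Hl). now split. }
  apply nondecreasing_of_derive with (Derive (picone Rf v v1)); [assumption | |];
    intros s Hs; now apply H.
Qed.

Lemma picone_zero_interval mu V v v1 Rf a b :
  0 <= mu -> linear_solution mu V v v1 -> 0 <= a -> riccati_super V (fun s => a < s < b) Rf ->
  (forall s, a < s < b -> picone Rf v v1 s = 0) -> forall s, a < s < b -> v s = 0.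
Proof.
  intros Hmu Hv Ha HR HF s Hs.
  destruct (picone_derive mu V v v1 _ Rf s Hmu Hv HR Hs ltac:(lra)) as (l & Hl & _ & Hpos).
  assert (l = 0) by now apply (derive_zero_fun (picone Rf v v1) a b s).
  destruct (Req_dec (v s) 0) as [|Hne]; [assumption |]. specialize (Hpos Hne). lra.
Qed.

Lemma riccati_super_sub V (I J : R -> Prop) Rf :
  (forall s, J s -> I s) -> riccati_super V I Rf -> riccati_super V J Rf.
Proof. intros HIJ HR s Hs. now apply HR, HIJ. Qed.

(** [picone] is nondecreasing on [(0, z]], and it is [0] at both ends. *)
Lemma regular_solution_vanishes mu V v v1 Rf z :
  0 <= mu -> linear_solution mu V v v1 -> near0 1 v -> near0 0 v1 ->
  riccati_super V (fun s => 0 < s <= z) Rf -> near0 0 (fun s => s * Rf s) ->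
  v z = 0 -> forall s, 0 < s < z -> v s = 0.
Proof.
  intros Hmu Hv Hv0 Hv1 HR HR0 Hz.
  apply (picone_zero_interval mu V v v1 Rf); [assumption | assumption | lra | |].
  - apply (riccati_super_sub V (fun s => 0 < s <= z)); [intros; lra | assumption].
  - intros s Hs.
    assert (Hup : picone Rf v v1 s <= 0).
    { replace 0 with (picone Rf v v1 z) by (unfold picone; rewrite Hz; ring).
      apply (picone_nondecreasing mu V); [assumption | assumption | lra | lra |].
      apply (riccati_super_sub V (fun s => 0 < s <= z)); [intros; lra | assumption]. }
    assert (Hlow : 0 <= picone Rf v v1 s); [| lra].
    assert (H : forall s, 0 < s <= z ->
      is_derive (picone Rf v v1) s (Derive (picone Rf v v1) s) /\ 0 <= Derive (picone Rf v v1) s).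
    { intros t Ht.
      destruct (picone_derive mu V v v1 _ Rf t Hmu Hv HR Ht ltac:(lra)) as (l & Hl & Hl0 & _).
      rewrite (is_derive_unique _ _ _ Hl). now split. }
    apply (nonneg_from_zero (picone Rf v v1) (Derive (picone Rf v v1)) z); [| | | lra].
    + intros t Ht. now apply H.
    + intros t Ht. now apply H.
    + (* [v = O(s)], so that [R v^2 = (s R) (v / s) v] *)
      assert (Hvs : near0 0 (fun s => v s * / s)).
      { destruct Hv0 as (C & d & Hd & HC). exists C, d. split; [assumption |].
        intros t Ht. specialize (HC t Ht). simpl. rewrite Rmult_1_r.
        rewrite Rabs_mult, Rabs_inv, (Rabs_right t) by lra.
        apply Rmult_le_reg_r with t; [lra |]. rewrite Rmult_assoc, Rinv_l by lra. simpl in HC. lra. }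
      apply near0_ext with (fun s => v s * v1 s + -1 * (v s * ((v s * / s) * (s * Rf s)))).
      { intros t Ht. unfold picone. field. lra. }
      apply near0_plus; [now apply (near0_mult 1 0) |]. apply near0_scal.
      apply (near0_mult 1 0); [assumption |]. now apply (near0_mult 0 0).
Qed.

(** Since [Rf >= 0], a positive value of [picone] bounds [v v'] from below for good and makes [v^2]
    grow at least linearly. *)
Lemma bounded_solution_vanishes mu V v v1 Rf c C :
  0 <= mu -> linear_solution mu V v v1 -> 0 < c ->
  riccati_super V (fun s => c <= s) Rf -> (forall s, c <= s -> 0 <= Rf s) ->
  0 <= picone Rf v v1 c ->
  (exists T, forall s, T <= s -> Rabs (v s) <= C) ->
  forall s, c < s -> v s = 0.
Proof.
  intros Hmu Hv Hc HR HR0 HF (T & HT) s Hs.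
  apply (picone_zero_interval mu V v v1 Rf c (s + 1)); [assumption | assumption | lra | | | lra].
  { apply (riccati_super_sub V (fun s => c <= s)); [intros; lra | assumption]. }
  intros t Ht.
  assert (Hmono : forall a b, c <= a -> a <= b -> picone Rf v v1 a <= picone Rf v v1 b).
  { intros a b Ha Hab. apply (picone_nondecreasing mu V); [assumption | assumption | lra | lra |].
    apply (riccati_super_sub V (fun s => c <= s)); [intros; lra | assumption]. }
  pose proof (Hmono c t ltac:(lra) ltac:(lra)) as H0.
  destruct (Req_dec (picone Rf v v1 t) 0) as [|Hne]; [assumption | exfalso].
  set (g := picone Rf v v1 t) in *. assert (Hg : 0 < g) by lra.
  set (T' := Rmax T (t + (C ^ 2 + 1) / g)).
  assert (T <= T') by apply Rmax_l. assert (t + (C ^ 2 + 1) / g <= T') by apply Rmax_r.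
  assert (HC2 : 0 <= C ^ 2) by apply pow2_ge_0.
  assert (0 < (C ^ 2 + 1) / g) by (apply Rdiv_lt_0_compat; lra).
  assert (Hgrow : v t ^ 2 - 2 * g * t <= v T' ^ 2 - 2 * g * T').
  { apply nondecreasing_of_derive with (f := fun u => v u ^ 2 - 2 * g * u)
      (f' := fun u => 2 * (v u * v1 u - g)); [lra | |].
    - intros x Hx. pose proof (lin_derive _ _ _ _ Hv x ltac:(lra)). derive. ring.
    - intros x Hx. pose proof (Hmono t x ltac:(lra) ltac:(lra)) as Hx'. fold g in Hx'.
      unfold picone in Hx'.
      assert (0 <= Rf x * v x ^ 2) by (apply Rmult_le_pos; [apply HR0; lra | apply pow2_ge_0]).
      lra. }
  assert (v T' ^ 2 <= C ^ 2).
  { specialize (HT T' ltac:(lra)). rewrite <- (pow2_abs (v T')). apply pow_incr.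
    split; [apply Rabs_pos | assumption]. }
  assert (g * (T' - t) >= C ^ 2 + 1).
  { apply Rle_ge. apply Rle_trans with (g * ((C ^ 2 + 1) / g)); [right; field; lra |].
    apply Rmult_le_compat_l; lra. }
  assert (0 <= v t ^ 2) by apply pow2_ge_0. nra.
Qed.

(** Gronwall's inequality for [v^2 + v'^2], forward with [sg = 1] and backward with [sg = -1]. *)
Lemma linear_uniqueness mu V v v1 t0 :
  linear_solution mu V v v1 ->
  (forall a, 0 < a -> exists K, forall t, a <= t -> Rabs (mu - V t) <= K) ->
  0 < t0 -> v t0 = 0 -> v1 t0 = 0 -> forall s, 0 < s -> v s = 0.
Proof.
  intros Hv HV Ht0 Hv0 Hv10 s Hs.
  destruct (HV (Rmin s t0) ltac:(now apply Rmin_pos)) as (K & HK).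
  assert (Hgen : forall sg x, sg = 1 \/ sg = -1 -> Rmin s t0 <= x ->
    is_derive (fun u => sg * ((v u ^ 2 + v1 u ^ 2) * exp (- sg * (1 + K) * u))) x
      (sg * ((2 * v x * v1 x * (1 + (mu - V x)) - sg * (1 + K) * (v x ^ 2 + v1 x ^ 2))
       * exp (- sg * (1 + K) * x))) /\
    sg * ((2 * v x * v1 x * (1 + (mu - V x)) - sg * (1 + K) * (v x ^ 2 + v1 x ^ 2))
       * exp (- sg * (1 + K) * x)) <= 0).
  { intros sg x Hsg Hx.
    assert (Hx0 : 0 < x) by (apply Rlt_le_trans with (Rmin s t0); [now apply Rmin_pos | assumption]).
    split.
    - pose proof (lin_derive _ _ _ _ Hv x Hx0). pose proof (lin_eqn _ _ _ _ Hv x Hx0).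
      derive. ring.
    - specialize (HK x Hx). apply Rabs_le_between in HK.
      set (m := mu - V x) in *. set (e := exp _). assert (He : 0 < e) by apply exp_pos.
      assert (H1 : 0 <= (v x - v1 x) ^ 2) by apply pow2_ge_0.
      assert (H2 : 0 <= (v x + v1 x) ^ 2) by apply pow2_ge_0.
      assert (HK0 : 0 <= K) by lra.
      assert (Hm : - (K * (v x ^ 2 + v1 x ^ 2)) <= 2 * v x * v1 x * m <= K * (v x ^ 2 + v1 x ^ 2)).
      { assert (0 <= (K - m) * (v x + v1 x) ^ 2) by (apply Rmult_le_pos; lra).
        assert (0 <= (K + m) * (v x - v1 x) ^ 2) by (apply Rmult_le_pos; lra).
        assert (0 <= (K - m) * (v x - v1 x) ^ 2) by (apply Rmult_le_pos; lra).
        assert (0 <= (K + m) * (v x + v1 x) ^ 2) by (apply Rmult_le_pos; lra).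
        split; nra. }
      destruct Hsg as [-> | ->].
      + assert (2 * v x * v1 x * (1 + m) - 1 * (1 + K) * (v x ^ 2 + v1 x ^ 2) <= 0) by nra. nra.
      + assert (0 <= 2 * v x * v1 x * (1 + m) - -1 * (1 + K) * (v x ^ 2 + v1 x ^ 2)) by nra. nra. }
  assert (Hzero : v s ^ 2 + v1 s ^ 2 <= 0).
  { destruct (Rle_dec t0 s) as [Hle | Hle].
    - assert (Hm : - (1 * ((v t0 ^ 2 + v1 t0 ^ 2) * exp (- (1) * (1 + K) * t0)))
                   <= - (1 * ((v s ^ 2 + v1 s ^ 2) * exp (- (1) * (1 + K) * s)))).
      { apply nondecreasing_of_derive with
          (f := fun u => - (1 * ((v u ^ 2 + v1 u ^ 2) * exp (- (1) * (1 + K) * u))))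
          (f' := fun x => - (1 * ((2 * v x * v1 x * (1 + (mu - V x)) - 1 * (1 + K) * (v x ^ 2 + v1 x ^ 2))
       * exp (- (1) * (1 + K) * x)))); [assumption | |];
          intros x Hx; destruct (Hgen 1 x) as [Hd Hn]; try (left; reflexivity);
          try (rewrite Rmin_right by lra; lra).
        - apply (derive_opp (fun u => 1 * ((v u ^ 2 + v1 u ^ 2) * exp (- (1) * (1 + K) * u)))).
          exact Hd.
        - lra. }
      rewrite Hv0, Hv10 in Hm. pose proof (exp_pos (- (1) * (1 + K) * s)).
      assert ((v s ^ 2 + v1 s ^ 2) * exp (- (1) * (1 + K) * s) <= 0) by lra. nra.
    - assert (Hm : - (-1 * ((v s ^ 2 + v1 s ^ 2) * exp (- (-1) * (1 + K) * s)))
                   <= - (-1 * ((v t0 ^ 2 + v1 t0 ^ 2) * exp (- (-1) * (1 + K) * t0)))).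
      { apply nondecreasing_of_derive with
          (f := fun u => - (-1 * ((v u ^ 2 + v1 u ^ 2) * exp (- (-1) * (1 + K) * u))))
          (f' := fun x => - (-1 * ((2 * v x * v1 x * (1 + (mu - V x)) - -1 * (1 + K) * (v x ^ 2 + v1 x ^ 2))
       * exp (- (-1) * (1 + K) * x)))); [lra | |];
          intros x Hx; destruct (Hgen (-1) x) as [Hd Hn]; try (right; reflexivity);
          try (rewrite Rmin_left by lra; lra).
        - apply (derive_opp (fun u => -1 * ((v u ^ 2 + v1 u ^ 2) * exp (- (-1) * (1 + K) * u)))).
          exact Hd.
        - lra. }
      rewrite Hv0, Hv10 in Hm. pose proof (exp_pos (- (-1) * (1 + K) * s)).
      assert ((v s ^ 2 + v1 s ^ 2) * exp (- (-1) * (1 + K) * s) <= 0) by lra. nra. }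
  assert (0 <= v1 s ^ 2) by apply pow2_ge_0. assert (0 <= v s ^ 2) by apply pow2_ge_0.
  assert (Hsq : v s ^ 2 = 0) by lra. destruct (Req_dec (v s) 0) as [|Hne]; [assumption |].
  now apply pow_nonzero with (n := 2%nat) in Hne.
Qed.

Lemma vanishes_everywhere mu V v v1 a b :
  linear_solution mu V v v1 ->
  (forall a, 0 < a -> exists K, forall t, a <= t -> Rabs (mu - V t) <= K) ->
  0 <= a < b -> (forall s, a < s < b -> v s = 0) -> forall s, 0 < s -> v s = 0.
Proof.
  intros Hv HV Hab H. set (t0 := (a + b) / 2).
  assert (Ht0 : a < t0 < b) by (unfold t0; lra).
  apply (linear_uniqueness mu V v v1 t0); try assumption; [lra | now apply H |].
  apply (derive_zero_fun v a b t0); try assumption. apply (lin_derive _ _ _ _ Hv). lra.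
Qed.

(** * Explicit supersolutions *)

(** [w = s * phi_inner (s^2)] is a rounded collocation solution of [p w'' + 10800 w = - 30000 s]
    for [p = p_top (s^2)], where [10800 / p] bounds [3 Y^2].  The exact solution with right-hand
    side [0] has its first zero where [s^2] is just above [1/8]. *)
Definition phi_inner : list Z :=
  (1000 :: -18038 :: 156675 :: -1067159 :: 5494932 :: -18138876 :: 27544300 :: nil)%Z.
(** A collocation solution of [p w'' + 10800 w = - 20000] with [w = 1000] and [w' = 378] at [1],
    rounded.  This slope is large enough for the tail, and small enough for the zero of [w] to lie
    below [6/17]. *)
Definition w_middle : list Z :=
  (1235 :: -23503 :: 121789 :: -292146 :: 409912 :: -357723 :: 191936 :: -58092 :: 7592 :: nil)%Z.

Definition riccati_inner (s : R) : R :=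
  1 / s + 2 * s * (peval (pderiv phi_inner) (s ^ 2) / peval phi_inner (s ^ 2)).
Definition riccati_middle (s : R) : R := peval (pderiv w_middle) s / peval w_middle s.
(** Proportionality to [tail_decay], which also bounds the potential, reduces the Riccati
    inequality to a polynomial one.  The linear factor makes up for the decreasing rate
    [2 / s] at which [s^-2] decays. *)
Definition riccati_tail (s : R) : R := 0.378 * tail_decay s * (1 + 0.2 * (s - 1)).

Lemma phi_inner_pos x : 0 <= x <= / 8 -> 0 < peval phi_inner x.
Proof.
  intros Hx. apply (positive_on_spec 136 0 17); [vm_compute; reflexivity | lia | lia | simpl; lra].
Qed.

Lemma w_middle_pos s : 6 / 17 <= s <= 1 -> 0 < peval w_middle s.
Proof.
  intros Hs. apply (positive_on_spec 51 18 33); [vm_compute; reflexivity | lia | lia | simpl; lra].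
Qed.

Lemma riccati_inner_super eps Y Y1 : rescaled_ground_state eps Y Y1 ->
  riccati_super (fun s => 3 * Y s ^ 2) (fun s => 0 < s <= 6 / 17) riccati_inner.
Proof.
  intros HY s Hs. destruct (potential_le _ _ _ HY) as [HV _]. specialize (HV s ltac:(lra)).
  assert (Hx : 0 <= s ^ 2 <= / 8).
  { split; [apply pow2_ge_0 |]. apply Rle_trans with ((6 / 17) ^ 2); [apply pow_incr |]; lra. }
  pose proof (phi_inner_pos _ Hx) as Hphi.
  pose proof (p_top_pos (s ^ 2) ltac:(lra)) as Hp.
  pose proof (derive_peval_square phi_inner s). pose proof (derive_peval_square (pderiv phi_inner) s).
  eexists. split.
  - unfold riccati_inner. derive; [lra | lra | reflexivity].
  - cbv beta. unfold riccati_inner.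
    assert (Hneg : 0 < peval (pscale (-1) (padd
       (pmul p_top (padd (pscale 6 (pderiv phi_inner))
                         (pscale 4 (0%Z :: pderiv (pderiv phi_inner)))))
       (pscale 10800 phi_inner))) (s ^ 2)).
    { apply (positive_on_spec 136 0 17); [vm_compute; reflexivity | lia | lia | simpl INR; lra]. }
    rewrite peval_scale, peval_add, peval_mul, peval_add, !peval_scale in Hneg.
    change (peval (0%Z :: pderiv (pderiv phi_inner)) (s ^ 2))
      with (0 + s ^ 2 * peval (pderiv (pderiv phi_inner)) (s ^ 2)) in Hneg.
    set (f := peval phi_inner (s ^ 2)) in *. set (f1 := peval (pderiv phi_inner) (s ^ 2)) in *.
    set (f2 := peval (pderiv (pderiv phi_inner)) (s ^ 2)) in *.
    set (N := peval p_top (s ^ 2)) in *.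
    apply Rle_lt_trans with ((6 * f1 + 4 * s ^ 2 * f2) / f + 3 * (3600 / N)).
    { apply Rplus_le_compat; [right; field; lra | lra]. }
    apply Rmult_lt_reg_r with (f * N); [now apply Rmult_lt_0_compat |].
    rewrite Rmult_0_l.
    replace (((6 * f1 + 4 * s ^ 2 * f2) / f + 3 * (3600 / N)) * (f * N))
      with (N * (6 * f1 + 4 * (0 + s ^ 2 * f2)) + 10800 * f) by (field; lra).
    lra.
Qed.

Lemma riccati_inner_origin : near0 0 (fun s => s * riccati_inner s).
Proof.
  assert (HI : near0 0 (fun s => / peval phi_inner (s ^ 2))).
  { apply near0_inv with 1000; [lra |].
    apply near0_ext with (fun s => s ^ 2 * peval (tl phi_inner) (s ^ 2)); [intros; simpl; ring |].
    apply (near0_weaken 2); [lia |].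
    apply (near0_mult 2 0); [apply near0_pow | apply near0_peval_square]. }
  apply near0_ext with (fun s => 1 + 2 * (s ^ 2 *
    (peval (pderiv phi_inner) (s ^ 2) * / peval phi_inner (s ^ 2)))).
  { intros s Hs. unfold riccati_inner, Rdiv. set (l := _ * / peval _ _). field. lra. }
  apply near0_plus; [apply near0_const |]. apply near0_scal.
  apply (near0_weaken 2); [lia |].
  apply (near0_mult 2 0); [apply near0_pow |].
  apply (near0_mult 0 0); [apply near0_peval_square | assumption].
Qed.

Lemma riccati_middle_super eps Y Y1 : rescaled_ground_state eps Y Y1 ->
  riccati_super (fun s => 3 * Y s ^ 2) (fun s => 6 / 17 <= s <= 1) riccati_middle.
Proof.
  intros HY s Hs. destruct (potential_le _ _ _ HY) as [HV _]. specialize (HV s ltac:(lra)).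
  pose proof (w_middle_pos _ Hs) as Hw.
  pose proof (p_top_pos _ (square_unit s ltac:(lra))) as Hp.
  pose proof (is_derive_peval w_middle s). pose proof (is_derive_peval (pderiv w_middle) s).
  eexists. split.
  - unfold riccati_middle. derive; [lra | reflexivity].
  - cbv beta. unfold riccati_middle.
    assert (Hneg : 0 < peval (pscale (-1) (padd
       (pmul (compose_square p_top) (pderiv (pderiv w_middle))) (pscale 10800 w_middle))) s).
    { apply (positive_on_spec 51 18 33); [vm_compute; reflexivity | lia | lia | simpl INR; lra]. }
    rewrite peval_scale, peval_add, peval_mul, peval_scale, peval_compose_square in Hneg.
    set (f := peval w_middle s) in *. set (f1 := peval (pderiv w_middle) s) in *.
    set (f2 := peval (pderiv (pderiv w_middle)) s) in *.
    set (N := peval p_top (s ^ 2)) in *.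
    apply Rle_lt_trans with (f2 / f + 3 * (3600 / N)).
    { apply Rplus_le_compat; [right; field; lra | lra]. }
    apply Rmult_lt_reg_r with (f * N); [now apply Rmult_lt_0_compat |].
    rewrite Rmult_0_l.
    replace ((f2 / f + 3 * (3600 / N)) * (f * N)) with (N * f2 + 10800 * f) by (field; lra).
    lra.
Qed.

Lemma tail_decay_pos s : 1 <= s -> 0 < tail_decay s.
Proof.
  intros Hs. apply Rdiv_lt_0_compat; [apply exp_pos | apply pow_lt; lra].
Qed.

Lemma tail_decay_derive s : 1 <= s -> is_derive tail_decay s (- (2.414 + 2 / s) * tail_decay s).
Proof.
  intros Hs. unfold tail_decay. derive; [apply pow_nonzero; lra |].
  set (e := exp _). field. lra.
Qed.

(** [exp (2.414 t) >= (1 + 1.207 t)^2] turns the exponential into a polynomial. *)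
Lemma tail_decay_le t : 0 <= t ->
  tail_decay (1 + t) * (1 + t) * (1 + 0.2 * t) ^ 2 * (1 + 3 * t) <= 1.
Proof.
  intros Ht. unfold tail_decay. replace (1 + t - 1) with t by ring.
  set (x := 1.207 * t).
  assert (Hx : 1 + x <= exp x) by (destruct (Req_dec x 0) as [E | E];
    [rewrite E, exp_0; lra | left; now apply exp_ineq1]).
  assert (Hx0 : 0 <= x) by (unfold x; lra).
  assert (He : exp (- (2.414 * t)) * exp x ^ 2 = 1).
  { simpl. rewrite Rmult_1_r, <- !exp_plus. transitivity (exp 0); [f_equal; unfold x; lra | apply exp_0]. }
  assert (H2 : (1 + x) ^ 2 <= exp x ^ 2) by (apply pow_incr; lra).
  apply Rmult_le_reg_r with (exp x ^ 2 * (1 + t)).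
  { apply Rmult_lt_0_compat; [apply pow_lt, exp_pos | lra]. }
  replace (exp (- (2.414 * t)) / (1 + t) ^ 2 * (1 + t) * (1 + 0.2 * t) ^ 2 * (1 + 3 * t)
     * (exp x ^ 2 * (1 + t)))
    with ((exp (- (2.414 * t)) * exp x ^ 2) * ((1 + 0.2 * t) ^ 2 * (1 + 3 * t))) by (field; lra).
  rewrite He, !Rmult_1_l.
  apply Rle_trans with ((1 + x) ^ 2 * (1 + t)); [| apply Rmult_le_compat_r; lra].
  unfold x. assert (0 <= t ^ 2) by apply pow2_ge_0. assert (0 <= t ^ 3) by now apply pow_le.
  nra.
Qed.

Lemma riccati_tail_super eps Y Y1 : rescaled_ground_state eps Y Y1 ->
  riccati_super (fun s => 3 * Y s ^ 2) (fun s => 1 <= s) riccati_tail.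
Proof.
  intros HY s' Hs'. replace s' with (1 + (s' - 1)) by ring.
  assert (Ht : 0 <= s' - 1) by lra. revert Ht. generalize (s' - 1). clear s' Hs'.
  intros t Ht. assert (Hs : 1 <= 1 + t) by lra.
  pose proof (potential_tail _ _ _ HY (1 + t) Hs) as HV.
  pose proof (tail_decay_derive (1 + t) Hs). pose proof (tail_decay_pos (1 + t) Hs) as HE.
  eexists. split.
  - unfold riccati_tail. derive. reflexivity.
  - cbv beta. unfold riccati_tail.
    pose proof (tail_decay_le t Ht) as Hle. set (E := tail_decay (1 + t)) in *.
    eapply Rle_lt_trans; [apply Rplus_le_compat_l; exact HV |].
    assert (Hcube : 0.142884 < (0.15649 - 0.26582 * t + 0.18249 * t ^ 2) * (1 + 3 * t)).
    { assert (0 <= t * (0.547 * (t - 0.5622) ^ 2 + 0.0307)).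
      { apply Rmult_le_pos; [assumption |]. pose proof (pow2_ge_0 (t - 0.5622)). lra. }
      assert (0 <= t ^ 2) by apply pow2_ge_0. assert (0 <= t ^ 3) by now apply pow_le. lra. }
    assert (Hsq : 0.142884 * (E * (1 + t) * (1 + 0.2 * t) ^ 2)
                  < 0.15649 - 0.26582 * t + 0.18249 * t ^ 2).
    { apply Rmult_lt_reg_r with (1 + 3 * t); [lra |].
      eapply Rle_lt_trans; [| exact Hcube]. lra. }
    apply Rmult_lt_reg_r with (1 + t); [lra |]. replace (0 * (1 + t)) with 0 by ring.
    match goal with |- ?l < 0 => replace l with
      (E * (0.378 ^ 2 * (E * (1 + t) * (1 + 0.2 * t) ^ 2)
        - (0.378 * ((1 + 0.2 * t) * (2 + 2.414 * (1 + t)) - 0.2 * (1 + t)) - 1.4364 * (1 + t))))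
      by (set (k := 2.414); set (r := 0.378); set (b := 0.2); set (V0 := 1.4364); field; lra) end.
    replace (0.378 ^ 2) with 0.142884 by lra.
    assert (0 < E * (0.378 * ((1 + 0.2 * t) * (2 + 2.414 * (1 + t)) - 0.2 * (1 + t))
       - 1.4364 * (1 + t) - 0.142884 * (E * (1 + t) * (1 + 0.2 * t) ^ 2))); [| lra].
    apply Rmult_lt_0_compat; [assumption |].
    assert (0 <= t ^ 2) by apply pow2_ge_0. lra.
Qed.

Lemma riccati_tail_nonneg s : 1 <= s -> 0 <= riccati_tail s.
Proof.
  intros Hs. pose proof (tail_decay_pos s Hs).
  apply Rmult_le_pos; [apply Rmult_le_pos |]; lra.
Qed.

Lemma riccati_tail_le_middle : riccati_tail 1 <= riccati_middle 1.
Proof.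
  unfold riccati_tail, riccati_middle, tail_decay.
  replace (- (2.414 * (1 - 1))) with 0 by ring. rewrite exp_0, pow1.
  replace (peval w_middle 1) with 1000 by (cbn [peval w_middle]; ring).
  replace (peval (pderiv w_middle) 1) with 378; [lra |].
  let q := eval vm_compute in (pderiv w_middle) in change (pderiv w_middle) with q.
  cbn [peval]. ring.
Qed.

(** * Absence of bounded regular solutions *)

(** If [v] kept one sign, its Wronskian with [q = s Y] would drive [v / q] to the other sign. *)
Lemma solution_has_zero eps Y Y1 mu v v1 :
  rescaled_ground_state eps Y Y1 -> mu <= eps ->
  linear_solution mu (fun s => 3 * Y s ^ 2) v v1 -> near0 1 v -> near0 0 v1 ->
  (forall s, 0 < s -> 0 < v s) -> False.
Proof.
  intros HY Hmu Hv Hv0 Hv1 Hpos.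
  set (q := fun s => s * Y s). set (p := fun s => Y s + s * Y1 s).
  assert (Hq0 : forall s, 0 < s -> 0 < q s) by (intros; now apply (rgs_q_pos _ _ _ HY)).
  assert (Hq : forall s, 0 < s -> is_derive q s (p s)) by exact (rgs_q_derive _ _ _ HY).
  assert (Hp : forall s, 0 < s -> is_derive p s ((eps - Y s ^ 2) * q s)) by exact (rgs_p_derive _ _ _ HY).
  set (W := fun s => v s * p s - v1 s * q s).
  assert (HWd : forall s, 0 < s -> is_derive W s (v s * q s * (eps - mu + 2 * Y s ^ 2))).
  { intros s Hs. pose proof (lin_derive _ _ _ _ Hv s Hs). pose proof (lin_eqn _ _ _ _ Hv s Hs).
    pose proof (Hq s Hs). pose proof (Hp s Hs). unfold W. derive. ring. }
  assert (HWpos : forall s, 0 < s -> 0 < v s * q s * (eps - mu + 2 * Y s ^ 2)).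
  { intros s Hs. apply Rmult_lt_0_compat; [apply Rmult_lt_0_compat; auto |].
    pose proof (rgs_pos _ _ _ HY s Hs). assert (0 < Y s ^ 2) by now apply pow_lt. lra. }
  assert (HP := rgs_profile _ _ _ HY 1). pose proof (profile_bounded _ _ _ _ HP) as BY.
  assert (HW0 : near0 1 W).
  { apply near0_ext with (fun s => v s * p s + -1 * (v1 s * q s)); [intros; unfold W; ring |].
    apply near0_plus.
    - apply (near0_mult 1 0); [assumption |].
      apply near0_plus; [assumption |].
      apply near0_ext with (fun s => s ^ 1 * Y1 s); [intros; ring |].
      apply (near0_weaken 1); [lia |].
      apply (near0_mult 1 0); [apply near0_pow | apply (profile_origin1 _ _ _ _ HP)].
    - apply near0_scal. apply (near0_mult 0 1); [assumption |].
      apply near0_ext with (fun s => s ^ 1 * Y s); [intros; unfold q; ring |].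
      apply (near0_mult 1 0); [apply near0_pow | assumption]. }
  assert (HWnn : forall s, 0 < s -> 0 <= W s).
  { intros s Hs. apply (nonneg_from_zero W (fun s => v s * q s * (eps - mu + 2 * Y s ^ 2)) s);
      [| | assumption | lra].
    - intros t Ht. apply HWd. lra.
    - intros t Ht. left. apply HWpos. lra. }
  assert (HWmono : forall a b, 0 < a -> a < b -> W a < W b).
  { intros a b Ha Hab. apply increasing_of_derive with
      (fun s => v s * q s * (eps - mu + 2 * Y s ^ 2)); [assumption | |].
    - intros x Hx. apply HWd. lra.
    - intros x Hx. apply HWpos. lra. }
  destruct (rgs_q_decay _ _ _ HY 1 ltac:(lra)) as (s0 & Hs0 & Hq1). fold q in Hq1.
  set (t0 := s0 + 1).
  assert (Hc : 0 < W t0).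
  { apply Rle_lt_trans with (W (t0 / 2)); [apply HWnn | apply HWmono]; unfold t0; lra. }
  set (T := t0 + (v t0 / q t0 + 1) / W t0).
  assert (Hvq : 0 < v t0 / q t0).
  { apply Rdiv_lt_0_compat; [apply Hpos | apply Hq0]; unfold t0; lra. }
  assert (HT : t0 < T).
  { unfold T. assert (0 < (v t0 / q t0 + 1) / W t0); [| lra]. apply Rdiv_lt_0_compat; lra. }
  assert (Hdec : - (v t0 / q t0) - W t0 * t0 <= - (v T / q T) - W t0 * T).
  { apply nondecreasing_of_derive with (f := fun s => - (v s / q s) - W t0 * s)
      (f' := fun s => W s / q s ^ 2 - W t0); [lra | |].
    - intros x Hx. pose proof (lin_derive _ _ _ _ Hv x ltac:(unfold t0 in Hx; lra)).
      pose proof (Hq x ltac:(unfold t0 in Hx; lra)). pose proof (Hq0 x ltac:(unfold t0 in Hx; lra)).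
      derive; [lra |]. unfold W. field. lra.
    - intros x Hx. assert (Hx0 : s0 <= x) by (unfold t0 in Hx; lra).
      specialize (Hq1 x Hx0). pose proof (Hq0 x ltac:(lra)) as Hqx.
      assert (HWx : W t0 <= W x).
      { destruct (Req_dec t0 x) as [-> |]; [lra |]. left. apply HWmono; unfold t0 in *; lra. }
      assert (Hq2 : q x ^ 2 <= 1) by (fold (q x) in Hq1; nra).
      assert (Hq2' : 0 < q x ^ 2) by now apply pow_lt.
      assert (W t0 <= W x / q x ^ 2); [| lra].
      apply Rmult_le_reg_r with (q x ^ 2); [assumption |].
      replace (W x / q x ^ 2 * q x ^ 2) with (W x) by (field; lra). nra. }
  assert (W t0 * (T - t0) = v t0 / q t0 + 1).
  { unfold T. field. split; [| lra]. pose proof (Hq0 t0 ltac:(unfold t0; lra)). lra. }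
  assert (0 < v T / q T).
  { apply Rdiv_lt_0_compat; [apply Hpos | apply Hq0]; unfold t0 in HT; lra. }
  lra.
Qed.

(** The position of one zero relative to the cut [6/17] decides which supersolution applies;
    at [1] the Riccati function jumps down or not at all, so [picone] cannot decrease. *)
Theorem bounded_regular_solution_zero eps Y Y1 mu v v1 C :
  rescaled_ground_state eps Y Y1 -> 0 <= mu <= eps ->
  linear_solution mu (fun s => 3 * Y s ^ 2) v v1 -> near0 1 v -> near0 0 v1 ->
  (exists T, forall s, T <= s -> Rabs (v s) <= C) ->
  forall s, 0 < s -> v s = 0.
Proof.
  intros HY Hmu Hv Hv0 Hv1 HC.
  set (V := fun s => 3 * Y s ^ 2) in *.
  assert (HV : forall a, 0 < a -> exists K, forall t, a <= t -> Rabs (mu - V t) <= K).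
  { intros a Ha. exists (mu + 3 * Y a ^ 2). intros t Ht. unfold V.
    pose proof (rgs_pos _ _ _ HY t ltac:(lra)) as HYt.
    assert (HYa : Y t <= Y a).
    { assert (- Y a <= - Y t); [| lra].
      apply nondecreasing_of_derive with (f := fun s => - Y s) (f' := fun s => - Y1 s);
        [assumption | |].
      - intros x Hx. apply (derive_opp Y), (rgs_derive _ _ _ HY). lra.
      - intros x Hx. pose proof (rgs_slope_neg _ _ _ HY x ltac:(lra)). lra. }
    assert (Y t ^ 2 <= Y a ^ 2) by (apply pow_incr; lra).
    assert (0 <= Y t ^ 2) by apply pow2_ge_0. apply Rabs_le_between. lra. }
  assert (Hz : exists z, 0 < z /\ v z = 0).
  { destruct (Classical_Prop.classic (exists z, 0 < z /\ v z = 0)) as [|Hno]; [assumption | exfalso].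
    assert (Hne : forall s, 0 < s -> v s <> 0) by (intros s Hs E; apply Hno; now exists s).
    assert (Hcont : forall s, 0 < s -> continuity_pt v s).
    { intros s Hs. eapply is_derive_continuity. now apply (lin_derive _ _ _ _ Hv). }
    (* a continuous function without zeros keeps its sign *)
    assert (Hsign : forall w, (forall s, 0 < s -> continuity_pt w s) ->
      (forall s, 0 < s -> w s <> 0) -> 0 < w 1 -> forall s, 0 < s -> 0 < w s).
    { intros w Hw Hw0 Hw1 s Hs.
      destruct (Rlt_dec 0 (w s)) as [|Hn]; [assumption | exfalso].
      assert (Hws : w s < 0) by (specialize (Hw0 s Hs); lra).
      destruct (Rtotal_order s 1) as [Hlt | [-> | Hgt]].
      - destruct (first_crossing w s 1) as (m & Hm & Hm0 & _); try lra.
        + intros x Hx. apply Hw. lra.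
        + apply (Hw0 m); lra.
      - lra.
      - destruct (first_crossing (fun s => - w s) 1 s) as (m & Hm & Hm0 & _); try lra.
        + intros x Hx. apply (continuity_pt_opp w), Hw. lra.
        + apply (Hw0 m); lra. }
    destruct (Rlt_dec 0 (v 1)) as [Hp | Hn].
    - apply (solution_has_zero eps Y Y1 mu v v1); try assumption; [lra | now apply Hsign].
    - apply (solution_has_zero eps Y Y1 mu (fun s => - v s) (fun s => - v1 s)); try assumption; [lra | | | |].
      + split.
        * intros s Hs. apply (derive_opp v), (lin_derive _ _ _ _ Hv). assumption.
        * intros s Hs. eapply is_derive_to; [apply (derive_opp v1), (lin_eqn _ _ _ _ Hv); assumption |].
          unfold V. ring.
      + apply near0_ext with (fun s => -1 * v s); [intros; ring | now apply near0_scal].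
      + apply near0_ext with (fun s => -1 * v1 s); [intros; ring | now apply near0_scal].
      + apply Hsign.
        * intros s Hs. now apply (continuity_pt_opp v), Hcont.
        * intros s Hs E. apply (Hne s Hs). lra.
        * specialize (Hne 1 ltac:(lra)). lra. }
  destruct Hz as (z & Hz & Hvz).
  assert (Htail : forall c, 1 <= c -> 0 <= picone riccati_tail v v1 c ->
    forall s, 0 < s -> v s = 0).
  { intros c Hc HF. apply (vanishes_everywhere mu V v v1 c (c + 1)); try assumption; [lra |].
    intros s Hs. apply (bounded_solution_vanishes mu V v v1 riccati_tail c C);
      try assumption; try lra.
    - apply (riccati_super_sub V (fun s => 1 <= s)); [intros; lra |].
      now apply riccati_tail_super with eps Y1.
    - intros t Ht. apply riccati_tail_nonneg. lra. }
  destruct (Rle_dec z (6 / 17)) as [Hle | Hgt].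
  - apply (vanishes_everywhere mu V v v1 0 z); try assumption; [lra |].
    apply (regular_solution_vanishes mu V v v1 riccati_inner z); try assumption; [lra | |
      exact riccati_inner_origin].
    apply (riccati_super_sub V (fun s => 0 < s <= 6 / 17)); [intros; lra |].
    now apply riccati_inner_super with eps Y1.
  - destruct (Rle_dec 1 z) as [Hz1 | Hz1].
    + apply (Htail z Hz1). unfold picone. rewrite Hvz. lra.
    + apply (Htail 1 ltac:(lra)).
      assert (Hmid : picone riccati_middle v v1 z <= picone riccati_middle v v1 1).
      { apply (picone_nondecreasing mu V); try assumption; try lra.
        apply (riccati_super_sub V (fun s => 6 / 17 <= s <= 1)); [intros; lra |].
        now apply riccati_middle_super with eps Y1. }
      assert (Hz0 : picone riccati_middle v v1 z = 0) by (unfold picone; rewrite Hvz; ring).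
      pose proof riccati_tail_le_middle. unfold picone in *.
      assert (0 <= v 1 ^ 2) by apply pow2_ge_0. nra.
Qed.

(** * Rescaling *)

Lemma D_in_halfline f d x0 : D_in f d (fun x => 0 <= x) x0 ->
  forall e, 0 < e -> exists a, 0 < a /\ forall x, 0 <= x -> x <> x0 -> Rabs (x - x0) < a ->
    Rabs ((f x - f x0) / (x - x0) - d x0) < e.
Proof.
  intros H e He. destruct (H e He) as (a & Ha & Hd). exists a. split; [assumption |].
  intros x Hx Hne Hxa. apply (Hd x). split; [split; [assumption | congruence] | exact Hxa].
Qed.

Lemma is_derive_of_D_in f d x0 : 0 < x0 -> D_in f d (fun x => 0 <= x) x0 ->
  is_derive f x0 (d x0).
Proof.
  intros Hx0 H. apply is_derive_Reals. intros e He.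
  destruct (D_in_halfline f d x0 H e He) as (a & Ha & Hd).
  assert (Hm : 0 < Rmin a x0) by now apply Rmin_pos.
  exists (mkposreal _ Hm). intros h Hh Hha. simpl in Hha.
  pose proof (Rmin_l a x0). pose proof (Rmin_r a x0).
  assert (Hhx : Rabs h < x0) by lra. apply Rabs_def2 in Hhx.
  specialize (Hd (x0 + h) ltac:(lra) ltac:(lra)). replace (x0 + h - x0) with h in Hd by ring.
  apply Hd. lra.
Qed.

Lemma near0_of_D_in f d : D_in f d (fun x => 0 <= x) 0 -> near0 1 (fun s => f s - f 0).
Proof.
  intros H. destruct (D_in_halfline f d 0 H 1 ltac:(lra)) as (a & Ha & Hd).
  exists (Rabs (d 0) + 1), a. split; [assumption |]. intros s Hs.
  specialize (Hd s ltac:(lra) ltac:(lra)). rewrite Rminus_0_r, (Rabs_right s) in Hd by lra.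
  specialize (Hd ltac:(lra)).
  replace (f s - f 0) with (((f s - f 0) / s - d 0 + d 0) * s) by (field; lra).
  rewrite Rabs_mult, (Rabs_right s) by lra. simpl. rewrite Rmult_1_r.
  apply Rmult_le_compat_r; [lra |].
  eapply Rle_trans; [apply Rabs_triang | lra].
Qed.

Lemma near0_dilate n f c : 0 < c -> near0 n f -> near0 n (fun s => f (c * s)).
Proof.
  intros Hc (C & d & Hd & H). exists (C * c ^ n), (d / c).
  split; [now apply Rdiv_lt_0_compat |]. intros s Hs.
  assert (Hcs : 0 < c * s < d).
  { split; [apply Rmult_lt_0_compat; lra |].
    apply Rmult_lt_reg_r with (/ c); [now apply Rinv_0_lt_compat |].
    replace (c * s * / c) with s by (field; lra). apply Hs. }
  specialize (H _ Hcs). rewrite Rpow_mult_distr in H. lra.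
Qed.

Lemma near0_of_derive f f' :
  (forall s, 0 < s -> is_derive f s (f' s)) -> near0 0 f' -> near0 0 f.
Proof.
  intros Hf (C & d & Hd & H). simpl in H.
  assert (HC : forall s, 0 < s < d -> Rabs (f' s) <= C).
  { intros s Hs. specialize (H s Hs). lra. }
  assert (HC0 : 0 <= C) by (specialize (HC (d / 2) ltac:(lra)); pose proof (Rabs_pos (f' (d / 2))); lra).
  exists (Rabs (f (d / 2)) + C * d), (d / 2). split; [lra |]. intros s Hs.
  simpl. rewrite Rmult_1_r.
  assert (H1 : C * s + f s <= C * (d / 2) + f (d / 2)).
  { apply nondecreasing_of_derive with (f := fun s => C * s + f s) (f' := fun s => C + f' s); [lra | |].
    - intros x Hx. pose proof (Hf x ltac:(lra)). derive. ring.
    - intros x Hx. specialize (HC x ltac:(lra)). apply Rabs_le_between in HC. lra. }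
  assert (H2 : C * s - f s <= C * (d / 2) - f (d / 2)).
  { apply nondecreasing_of_derive with (f := fun s => C * s - f s) (f' := fun s => C - f' s); [lra | |].
    - intros x Hx. pose proof (Hf x ltac:(lra)). derive. ring.
    - intros x Hx. specialize (HC x ltac:(lra)). apply Rabs_le_between in HC. lra. }
  assert (0 <= C * s) by (apply Rmult_le_pos; lra).
  pose proof (Rle_abs (f (d / 2))). pose proof (Rabs_maj2 (f (d / 2))).
  assert (0 <= C * d) by (apply Rmult_le_pos; lra).
  apply Rabs_le_between. lra.
Qed.

Lemma derive_dilate f c s l : is_derive f (c * s) l -> is_derive (fun s => f (c * s)) s (c * l).
Proof.
  intros H. apply (derive_comp f (fun s => c * s)); [assumption |]. derive. ring.
Qed.

Lemma ground_state_rescaled Q : ground_state Q ->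
  let c := 6 / Q 0 in
  0 < c /\ exists Y1, rescaled_ground_state (c ^ 2) (fun s => c * Q (c * s)) Y1.
Proof.
  intros ((D & HD0 & HD) & Hpos & Hlim & Heq) c.
  assert (HQ0 : 0 < Q 0) by (apply Hpos; lra).
  assert (Hc : 0 < c) by (apply Rdiv_lt_0_compat; lra).
  split; [assumption |].
  assert (HQd : forall r, 0 < r -> is_derive Q r (D 1%nat r)).
  { intros r Hr. apply is_derive_ext_loc with (D 0%nat).
    - exists (mkposreal _ Hr). intros t Ht.
      unfold ball in Ht; simpl in Ht; unfold AbsRing_ball, abs, minus, plus, opp in Ht; simpl in Ht.
      apply Rabs_def2 in Ht. apply HD0. lra.
    - apply is_derive_of_D_in; [assumption | apply HD; lra]. }
  assert (HQ1d : forall r, 0 < r -> is_derive (D 1%nat) r (D 2%nat r)).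
  { intros r Hr. apply is_derive_of_D_in; [assumption | apply HD; lra]. }
  assert (HQeq : forall r, 0 < r -> D 2%nat r = Q r - Q r ^ 3 - 2 / r * D 1%nat r).
  { intros r Hr. specialize (Heq r Hr).
    assert (HD1 : Derive Q r = D 1%nat r) by (apply is_derive_unique; auto).
    assert (HD2 : Derive_n Q 2 r = D 2%nat r).
    { change (Derive (Derive Q) r = D 2%nat r).
      rewrite (Derive_ext_loc (Derive Q) (D 1%nat) r); [apply is_derive_unique; auto |].
      exists (mkposreal _ Hr). intros t Ht.
      unfold ball in Ht; simpl in Ht; unfold AbsRing_ball, abs, minus, plus, opp in Ht; simpl in Ht.
      apply Rabs_def2 in Ht. apply is_derive_unique, HQd. lra. }
    rewrite HD1, HD2 in Heq. lra. }
  assert (Hcs : forall s, 0 < s -> 0 < c * s) by (intros; now apply Rmult_lt_0_compat).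
  exists (fun s => c ^ 2 * D 1%nat (c * s)). split.
  - now apply pow_lt.
  - intros b. split.
    + intros s Hs. apply Rmult_lt_0_compat; [assumption |]. apply Hpos. left. apply Hcs. lra.
    + intros s Hs. pose proof (derive_dilate _ c s _ (HQd (c * s) (Hcs s ltac:(lra)))).
      derive. ring.
    + intros s Hs. pose proof (derive_dilate _ c s _ (HQ1d (c * s) (Hcs s ltac:(lra)))).
      derive. rewrite HQeq by (apply Hcs; lra). field. split; lra.
    + apply near0_ext with (fun s => c * (D 0%nat (c * s) - D 0%nat 0)).
      { intros s Hs. rewrite !HD0 by (try (left; now apply Hcs); lra). unfold c. field. lra. }
      apply near0_scal. apply (near0_dilate 1 (fun s => D 0%nat s - D 0%nat 0)); [assumption |].
      apply near0_of_D_in with (D 1%nat). apply HD. lra.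
    + apply near0_scal, near0_dilate; [assumption |].
      apply near0_ext with (fun s => (D 1%nat s - D 1%nat 0) + D 1%nat 0); [intros; ring |].
      apply near0_plus; [| apply near0_const].
      apply (near0_weaken 1); [lia |]. apply near0_of_D_in with (D 2%nat). apply HD. lra.
  - intros eta Heta. apply is_lim_spec in Hlim.
    assert (Hec : 0 < eta / c) by now apply Rdiv_lt_0_compat.
    destruct (Hlim (mkposreal _ Hec)) as (M & HM). simpl in HM.
    exists (Rmax 1 ((M + 1) / c)).
    pose proof (Rmax_l 1 ((M + 1) / c)). pose proof (Rmax_r 1 ((M + 1) / c)).
    split; [lra |]. intros s Hs.
    assert (HMs : M < c * s).
    { apply Rlt_le_trans with (c * ((M + 1) / c)); [| apply Rmult_le_compat_l; lra].
      replace (c * ((M + 1) / c)) with (M + 1) by (field; lra). lra. }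
    specialize (HM _ HMs). rewrite Rminus_0_r in HM.
    pose proof (Rle_abs (Q (c * s))).
    replace eta with (c * (eta / c)) by (field; lra).
    apply Rmult_lt_compat_l; lra.
Qed.

Theorem theorem4p1 (Q : R -> R) (hQ : unique_ground_state Q)
  (lam : R) (hlam : 0 <= lam <= 1) :
  ~ eigenvalue_or_resonance Q lam.
Proof.
  intros (u & Hu & (r0 & Hr0 & Hne) & (M & d & HM) & (C & T & HC)).
  destruct hQ as [HQ _].
  destruct (ground_state_rescaled Q HQ) as (Hc & Y1 & HY).
  set (c := 6 / Q 0) in *. set (Y := fun s => c * Q (c * s)) in *.
  set (mu := c ^ 2 * (1 - lam)).
  assert (Hcs : forall s, 0 < s -> 0 < c * s) by (intros; now apply Rmult_lt_0_compat).
  set (v := fun s => s * u (c * s)).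
  set (v1 := fun s => u (c * s) + s * (c * Derive u (c * s))).
  assert (Hc2 : 0 < c ^ 2) by now apply pow_lt.
  assert (Hmu : 0 <= mu <= c ^ 2).
  { unfold mu. split; [apply Rmult_le_pos; lra |].
    rewrite <- (Rmult_1_r (c ^ 2)) at 2. apply Rmult_le_compat_l; lra. }
  assert (Hv : linear_solution mu (fun s => 3 * Y s ^ 2) v v1).
  { split; intros s Hs; destruct (Hu (c * s) (Hcs s Hs)) as (Hd & Hd2 & Heq);
      pose proof (derive_dilate u c s _ (Derive_correct _ _ Hd)).
    - unfold v, v1. derive. ring.
    - pose proof (derive_dilate (Derive u) c s _ (Derive_correct _ _ Hd2)) as H2.
      change (Derive (Derive_n u 1) (c * s)) with (Derive_n u 2 (c * s)) in H2.
      unfold v1. derive. unfold Lplus in Heq.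
      assert (E : Derive_n u 2 (c * s) = - (2 / (c * s)) * Derive u (c * s)
        + (1 - 3 * Q (c * s) ^ 2 - lam) * u (c * s)) by lra.
      rewrite E. unfold mu, Y, v. field. split; lra. }
  assert (Hv0 : near0 1 v).
  { apply near0_ext with (fun s => s ^ 1 * u (c * s)); [intros; unfold v; ring |].
    apply (near0_mult 1 0); [apply near0_pow |]. apply near0_dilate; [assumption |].
    exists M, d. split; [apply cond_pos |]. intros s Hs. simpl. rewrite Rmult_1_r.
    apply HM; [| lra].
    unfold ball; simpl; unfold AbsRing_ball, abs, minus, plus, opp; simpl.
    rewrite Ropp_0, Rplus_0_r, Rabs_right; lra. }
  assert (Hv1 : near0 0 v1).
  { apply near0_of_derive with (fun s => (mu - 3 * Y s ^ 2) * v s).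
    - intros s Hs. now apply (lin_eqn _ _ _ _ Hv).
    - apply (near0_mult 0 0); [| apply (near0_weaken 1); [lia | assumption]].
      pose proof (profile_bounded _ _ _ _ (rgs_profile _ _ _ HY 1)) as BY.
      apply near0_ext with (fun s => mu + -3 * (Y s * Y s)); [intros; ring |].
      apply near0_plus; [apply near0_const |]. apply near0_scal. now apply (near0_mult 0 0). }
  assert (Hbound : exists T', forall s, T' <= s -> Rabs (v s) <= Rabs C / c).
  { exists (Rmax 1 ((T + 1) / c)). intros s Hs.
    pose proof (Rmax_l 1 ((T + 1) / c)). pose proof (Rmax_r 1 ((T + 1) / c)).
    assert (HTs : T < c * s).
    { apply Rlt_le_trans with (c * ((T + 1) / c)); [| apply Rmult_le_compat_l; lra].
      replace (c * ((T + 1) / c)) with (T + 1) by (field; lra). lra. }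
    specialize (HC _ HTs). pose proof (Hcs s ltac:(lra)) as Hcs'.
    unfold v. rewrite Rabs_mult, (Rabs_right s) by lra.
    assert (He : exp (- (c * s) * sqrt (1 - lam)) <= 1).
    { apply Rle_trans with (exp 0); [| rewrite exp_0; lra].
      assert (0 <= c * s * sqrt (1 - lam))
        by (apply Rmult_le_pos; [lra | apply sqrt_pos]).
      destruct (Req_dec (- (c * s) * sqrt (1 - lam)) 0) as [-> | Hn]; [lra |].
      left. apply exp_increasing. lra. }
    apply Rle_trans with (s * (Rabs C * (/ (c * s) * 1))); [| right; field; lra].
    apply Rmult_le_compat_l; [lra |]. eapply Rle_trans; [exact HC |].
    assert (0 < / (c * s)) by now apply Rinv_0_lt_compat.
    pose proof (exp_pos (- (c * s) * sqrt (1 - lam))).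
    assert (0 <= / (c * s) * exp (- (c * s) * sqrt (1 - lam)) <= / (c * s) * 1).
    { split; [apply Rmult_le_pos; lra | apply Rmult_le_compat_l; lra]. }
    pose proof (Rle_abs C). pose proof (Rabs_pos C). nra. }
  assert (Hs0 : 0 < r0 / c) by now apply Rdiv_lt_0_compat.
  pose proof (bounded_regular_solution_zero _ _ _ _ _ _ _ HY Hmu Hv Hv0 Hv1 Hbound _ Hs0) as H0.
  unfold v in H0. replace (c * (r0 / c)) with r0 in H0 by (field; lra).
  apply Rmult_integral in H0. destruct H0 as [H0 | H0]; [lra | contradiction].
Qed.
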